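(* Let $n,N,N'\ge1$ and let $\sigma_{i\alpha\beta}\in\bar U(n)$ for $i=1,\dots,n$, $\alpha=1,\dots,N'$, $\beta=1,\dots,N$. Assume that at least one of the numbers $N$ and $N'$ is bigger than $1$. Then the ring $\mathcal L$ has the Poincaré–Birkhoff–Witt property if and only if $$\sigma_{i\alpha\beta}=\sigma_{\alpha\beta}\ \text{ for all } i,\alpha,\beta,\quad\text{for some }\ \sigma_{\alpha\beta}\in\mathbb K.$$
   Context: $\mathbb K$ is a field of characteristic $0$. $U(n)=\mathbb K[\tilde h_1,\dots,\tilde h_n]$ is the commutative polynomial ring, $\tilde h_{ij}=\tilde h_i-\tilde h_j$, and $\bar U(n)$ is the localization of $U(n)$ with respect to the multiplicative set generated by all $\tilde h_{ij}+a$, $a\in\mathbb Z$, $i\ne j$. The elements $\mathrm R^{ij}_{kl}\in\bar U(n)$, $i,j,k,l=1,\dots,n$, have as only nonzero values $$\mathrm R^{ij}_{ij}=\frac1{\tilde h_{ij}}\ (i\ne j),\qquad \mathrm R^{ij}_{ji}=\begin{cases}\dfrac{\tilde h_{ij}^2-1}{\tilde h_{ij}^2},&i<j,\\[1ex]1,&i\ge j.\end{cases}$$ $\mathcal L$ is the ring generated over $\bar U(n)$ by $x^{i\alpha}$, $i=1,\dots,n$, $\alpha=1,\dots,N'$, and $\bar\partial_{j\beta}$, $j=1,\dots,n$, $\beta=1,\dots,N$, with the defining relations $$\tilde h_ix^{j\alpha}=x^{j\alpha}(\tilde h_i+\delta_{ij}),\qquad \tilde h_i\bar\partial_{j\beta}=\bar\partial_{j\beta}(\tilde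 h_i-\delta_{ij}),$$ $$x^{i\alpha}x^{j\beta}=\sum_{k,l}\mathrm R^{ij}_{kl}\,x^{k\beta}x^{l\alpha},\qquad \bar\partial_{l\alpha}\bar\partial_{k\beta}=\sum_{i,j}\bar\partial_{j\beta}\bar\partial_{i\alpha}\,\mathrm R^{ij}_{kl},$$ $$x^{i\alpha}\bar\partial_{j\beta}=\sum_{k,l}\bar\partial_{k\beta}\,\mathrm R^{ki}_{lj}\,x^{l\alpha}-\delta_{ij}\,\sigma_{i\alpha\beta},$$ for all admissible values of the indices. The Poincaré–Birkhoff–Witt property of $\mathcal L$ means that multiplication gives an isomorphism of $\bar U(n)$-modules $V^*(n,N)\otimes_{\bar U(n)}V(n,N')\cong\mathcal L$, where $V(n,N')$ is the ring generated over $\bar U(n)$ by the $x^{i\alpha}$, $i=1,\dots,n$, $\alpha=1,\dots,N'$, with the defining relations $\tilde h_ix^{j\alpha}=x^{j\alpha}(\tilde h_i+\delta_{ij})$ and $x^{i\alpha}x^{j\beta}=\sum_{k,l}\mathrm R^{ij}_{kl}\,x^{k\beta}x^{l\alpha}$, and $V^*(n,N)$ is the ring generated over $\bar U(n)$ by the $\bar\partial_{j\beta}$, $j=1,\dots,n$, $\beta=1,\dots,N$, with the defining relations $\tilde h_i\bar\partial_{j\beta}=\bar\partial_{j\beta}(\tilde h_i-\delta_{ij})$ and $\bar\partial_{l\alpha}\bar\partial_{k\beta}=\sum_{i,j}\bar\partial_{j\beta}\bar\partial_{i\alpha}\,\mathrm R^{ij}_{kl}$; equivalently, fixing orders on the set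 of $x^{i\alpha}$ and on the set of $\bar\partial_{j\beta}$, the products of an ordered monomial in the $\bar\partial_{j\beta}$ followed by an ordered monomial in the $x^{i\alpha}$ form a basis of the left $\bar U(n)$-module $\mathcal L$. *)

(* Defs.v *)
From HB Require Import structures.
From mathcomp Require Import all_boot all_order all_algebra.
From mathcomp Require Import fraction generic_quotient boolp mpoly.

Set Implicit Arguments.
Unset Strict Implicit.
Unset Printing Implicit Defensive.

Import GRing.Theory.
Local Open Scope ring_scope.
Local Open Scope quotient_scope.

(* Given a ring B, a type of generators G and a relation Rel on noncommutative
   ring expressions over B and G, [presented Rel] is the ring generated over B
   by G with defining relations Rel: expressions modulo the smallest ring
   congruence that contains Rel and makes TCst a ring morphism.  Elements of B
   need not commute with the generators. *)

Inductive term (B G : Type) : Type :=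
  | TCst of B
  | TGen of G
  | TOpp of term B G
  | TAdd of term B G & term B G
  | TMul of term B G & term B G.
Arguments TCst {B G}.
Arguments TGen {B G}.

Declare Scope term_scope.
Delimit Scope term_scope with T.
Bind Scope term_scope with term.
Notation "- s" := (TOpp s) : term_scope.
Notation "s + t" := (TAdd s t) : term_scope.
Notation "s - t" := (TAdd s (TOpp t)) : term_scope.
Notation "s * t" := (TMul s t) : term_scope.
Notation "\sum_ ( i < n ) s" :=
  (\big[@TAdd _ _/TCst 0%R]_(i < n) s%T) : term_scope.

Inductive cong (B : pzRingType) (G : Type) (Rel : term B G -> term B G -> Prop) :
    term B G -> term B G -> Prop :=
  | CRel s t : Rel s t -> cong Rel s t
  | CRefl s : cong Rel s s
  | CSym s t : cong Rel s t -> cong Rel t s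
  | CTrans s t u : cong Rel s t -> cong Rel t u -> cong Rel s u
  | COpp s s' : cong Rel s s' -> cong Rel (- s) (- s')
  | CAdd s s' t t' :
      cong Rel s s' -> cong Rel t t' -> cong Rel (s + t) (s' + t')
  | CMul s s' t t' :
      cong Rel s s' -> cong Rel t t' -> cong Rel (s * t) (s' * t')
  | CaddA s t u : cong Rel (s + (t + u)) ((s + t) + u)
  | CaddC s t : cong Rel (s + t) (t + s)
  | Cadd0 s : cong Rel (TCst 0%R + s) s
  | CaddN s : cong Rel (- s + s) (TCst 0%R)
  | CmulA s t u : cong Rel (s * (t * u)) ((s * t) * u)
  | Cmul1l s : cong Rel (TCst 1%R * s) s
  | Cmul1r s : cong Rel (s * TCst 1%R) s
  | CmulDl s t u : cong Rel ((s + t) * u) (s * u + t * u)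
  | CmulDr s t u : cong Rel (s * (t + u)) (s * t + s * u)
  | CcstD b c : cong Rel (TCst (b + c)%R) (TCst b + TCst c)
  | CcstM b c : cong Rel (TCst (b * c)%R) (TCst b * TCst c).

Section Presented.
Variables (B : pzRingType) (G : Type) (Rel : term B G -> term B G -> Prop).

Definition congb : rel {classic (term B G)} :=
  fun s t => `[< cong Rel s t >].

Lemma congb_refl : reflexive congb.
Proof. by move=> s; apply/asboolP/CRefl. Qed.

Lemma congb_sym : ssrbool.symmetric congb.
Proof. by move=> s t; apply/asboolP/asboolP => /CSym. Qed.

Lemma congb_trans : transitive congb.
Proof.
by move=> t s u /asboolP st /asboolP tu; apply/asboolP/(CTrans st tu).
Qed.

Canonical congb_equiv := EquivRel congb congb_refl congb_sym congb_trans.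

Definition presented : Type := {eq_quot congb}.
HB.instance Definition _ := Choice.on presented.
HB.instance Definition _ := EqQuotient.on presented.

Definition cls (s : term B G) : presented := \pi_presented s.
Definition rep (x : presented) : term B G := repr x.

Lemma clsP s t : cls s = cls t <-> cong Rel s t.
Proof.
by split=> [/(@eqmodP _ congb_equiv)/asboolP | /asboolP/(@eqmodP _ congb_equiv)].
Qed.

Lemma repK : cancel rep cls.
Proof. exact: reprK. Qed.

Lemma rep_cls s : cong Rel (rep (cls s)) s.
Proof. by apply/clsP; rewrite repK. Qed.

Definition padd x y := cls (rep x + rep y).
Definition pmul x y := cls (rep x * rep y).
Definition popp x := cls (- rep x).

Lemma paddE s t : padd (cls s) (cls t) = cls (s + t).
Proof. by apply/clsP/CAdd; exact: rep_cls. Qed.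

Lemma pmulE s t : pmul (cls s) (cls t) = cls (s * t).
Proof. by apply/clsP/CMul; exact: rep_cls. Qed.

Lemma poppE s : popp (cls s) = cls (- s).
Proof. by apply/clsP/COpp; exact: rep_cls. Qed.

Fact paddA : associative padd.
Proof.
move=> x y z; rewrite -[x]repK -[y]repK -[z]repK !paddE.
by apply/clsP/CaddA.
Qed.

Fact paddC : commutative padd.
Proof.
by move=> x y; rewrite -[x]repK -[y]repK !paddE; apply/clsP/CaddC.
Qed.

Fact padd0 : left_id (cls (TCst 0)) padd.
Proof. by move=> x; rewrite -[x]repK paddE; apply/clsP/Cadd0. Qed.

Fact paddN : left_inverse (cls (TCst 0)) popp padd.
Proof. by move=> x; rewrite -[x]repK poppE paddE; apply/clsP/CaddN. Qed.

Fact pmulA : associative pmul.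
Proof.
move=> x y z; rewrite -[x]repK -[y]repK -[z]repK !pmulE.
by apply/clsP/CmulA.
Qed.

Fact pmul1l : left_id (cls (TCst 1)) pmul.
Proof. by move=> x; rewrite -[x]repK pmulE; apply/clsP/Cmul1l. Qed.

Fact pmul1r : right_id (cls (TCst 1)) pmul.
Proof. by move=> x; rewrite -[x]repK pmulE; apply/clsP/Cmul1r. Qed.

Fact pmulDl : left_distributive pmul padd.
Proof.
move=> x y z; rewrite -[x]repK -[y]repK -[z]repK !(paddE, pmulE).
by apply/clsP/CmulDl.
Qed.

Fact pmulDr : right_distributive pmul padd.
Proof.
move=> x y z; rewrite -[x]repK -[y]repK -[z]repK !(paddE, pmulE).
by apply/clsP/CmulDr.
Qed.

HB.instance Definition _ :=
  GRing.isZmodule.Build presented paddA paddC padd0 paddN.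
HB.instance Definition _ :=
  GRing.Zmodule_isPzRing.Build presented pmulA pmul1l pmul1r pmulDl pmulDr.

Lemma clsD s t : cls (s + t)%T = cls s + cls t.
Proof. by rewrite -paddE. Qed.

Lemma clsM s t : cls (s * t)%T = cls s * cls t.
Proof. by rewrite -pmulE. Qed.

Lemma clsN s : cls (- s)%T = - cls s.
Proof. by rewrite -poppE. Qed.

Definition cst (b : B) : presented := cls (TCst b).
Definition gen (g : G) : presented := cls (TGen g).

Fact cst_is_semi_additive : nmod_morphism cst.
Proof. by split=> // b c; rewrite /cst -clsD; apply/clsP/CcstD. Qed.

Fact cst_is_monoid_morphism : monoid_morphism cst.
Proof. by split=> // b c; rewrite /cst -clsM; apply/clsP/CcstM. Qed.

HB.instance Definition _ :=
  GRing.isNmodMorphism.Build B presented cst cst_is_semi_additive.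
HB.instance Definition _ :=
  GRing.isMonoidMorphism.Build B presented cst cst_is_monoid_morphism.

Definition pscale (b : B) (x : presented) := cst b * x.

Fact pscaleA b c x : pscale b (pscale c x) = pscale (b * c) x.
Proof. by rewrite /pscale rmorphM mulrA. Qed.

Fact pscale1 : left_id 1 pscale.
Proof. by move=> x; rewrite /pscale rmorph1 mul1r. Qed.

Fact pscaleDr : right_distributive pscale +%R.
Proof. by move=> b x y; rewrite /pscale mulrDr. Qed.

Fact pscaleDl x : {morph pscale^~ x : b c / b + c}.
Proof. by move=> b c; rewrite /pscale rmorphD mulrDl. Qed.

HB.instance Definition _ := GRing.Zmodule_isLmodule.Build B presented
  pscaleA pscale1 pscaleDr pscaleDl.

Fixpoint eval (A : pzRingType) (f : B -> A) (g : G -> A) (s : term B G) : A :=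
  match s with
  | TCst b => f b
  | TGen x => g x
  | TOpp s => - eval f g s
  | TAdd s t => eval f g s + eval f g t
  | TMul s t => eval f g s * eval f g t
  end.

Section Lift.
Variables (A : pzRingType) (f : {rmorphism B -> A}) (g : G -> A).

(* The ring morphism extending f and g, provided that g respects Rel. *)
Definition lift (x : presented) : A := eval f g (rep x).

Hypothesis gP : forall s t, Rel s t -> eval f g s = eval f g t.

Lemma eval_cong s t : cong Rel s t -> eval f g s = eval f g t.
Proof.
elim=> //=.
- by move=> u v w _ -> _ ->.
- by move=> ? ? _ ->.
- by move=> ? ? ? ? _ -> _ ->.
- by move=> ? ? ? ? _ -> _ ->.
- by move=> *; rewrite addrA.
- by move=> *; rewrite addrC.
- by move=> *; rewrite rmorph0 add0r.
- by move=> *; rewrite rmorph0 addNr.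
- by move=> *; rewrite mulrA.
- by move=> *; rewrite rmorph1 mul1r.
- by move=> *; rewrite rmorph1 mulr1.
- by move=> *; rewrite mulrDl.
- by move=> *; rewrite mulrDr.
- by move=> *; rewrite rmorphD.
- by move=> *; rewrite rmorphM.
Qed.

Lemma lift_cls s : lift (cls s) = eval f g s.
Proof. exact/eval_cong/rep_cls. Qed.

Lemma lift_gen x : lift (gen x) = g x.
Proof. exact: lift_cls. Qed.

Lemma lift_cst b : lift (cst b) = f b.
Proof. exact: lift_cls. Qed.

Lemma lift_is_nmod_morphism : nmod_morphism lift.
Proof.
split=> [|x y]; first by rewrite (lift_cls (TCst 0)) /= rmorph0.
by rewrite -[x]repK -[y]repK -clsD !lift_cls.
Qed.

Lemma lift_is_monoid_morphism : monoid_morphism lift.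
Proof.
split=> [|x y]; first by rewrite (lift_cls (TCst 1)) /= rmorph1.
by rewrite -[x]repK -[y]repK -clsM !lift_cls.
Qed.

End Lift.
End Presented.

Arguments eval {B G A}.

(* The tensor product over B of rings A1 and A2 under B, where A1 is a right
   B-module through f1 and A2 a left B-module through f2; it is regarded as a
   left B-module through A1. *)

Inductive tterm (A1 A2 : Type) : Type :=
  | TenZero
  | TenPure of A1 & A2
  | TenOpp of tterm A1 A2
  | TenAdd of tterm A1 A2 & tterm A1 A2.
Arguments TenZero {A1 A2}.

Inductive tcong (B A1 A2 : pzRingType) (f1 : B -> A1) (f2 : B -> A2) :
    tterm A1 A2 -> tterm A1 A2 -> Prop :=
  | TRefl s : tcong f1 f2 s s
  | TSym s t : tcong f1 f2 s t -> tcong f1 f2 t s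
  | TTrans s t u : tcong f1 f2 s t -> tcong f1 f2 t u -> tcong f1 f2 s u
  | TCongOpp s s' : tcong f1 f2 s s' -> tcong f1 f2 (TenOpp s) (TenOpp s')
  | TCongAdd s s' t t' : tcong f1 f2 s s' -> tcong f1 f2 t t' ->
      tcong f1 f2 (TenAdd s t) (TenAdd s' t')
  | TaddA s t u :
      tcong f1 f2 (TenAdd s (TenAdd t u)) (TenAdd (TenAdd s t) u)
  | TaddC s t : tcong f1 f2 (TenAdd s t) (TenAdd t s)
  | Tadd0 s : tcong f1 f2 (TenAdd TenZero s) s
  | TaddN s : tcong f1 f2 (TenAdd (TenOpp s) s) TenZero
  | TpureDl a a' b : tcong f1 f2
      (TenPure (a + a') b) (TenAdd (TenPure a b) (TenPure a' b))
  | TpureDr a b b' : tcong f1 f2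
      (TenPure a (b + b')) (TenAdd (TenPure a b) (TenPure a b'))
  | Tbalanced a u b : tcong f1 f2 (TenPure (a * f1 u) b) (TenPure a (f2 u * b)).

Section Tensor.
Variables (B A1 A2 : pzRingType).
Variables (f1 : {rmorphism B -> A1}) (f2 : {rmorphism B -> A2}).

Definition tcongb : rel {classic (tterm A1 A2)} :=
  fun s t => `[< tcong f1 f2 s t >].

Lemma tcongb_refl : reflexive tcongb.
Proof. by move=> s; apply/asboolP/TRefl. Qed.

Lemma tcongb_sym : ssrbool.symmetric tcongb.
Proof. by move=> s t; apply/asboolP/asboolP => /TSym. Qed.

Lemma tcongb_trans : transitive tcongb.
Proof.
by move=> t s u /asboolP st /asboolP tu; apply/asboolP/(TTrans st tu).
Qed.

Canonical tcongb_equiv := EquivRel tcongb tcongb_refl tcongb_sym tcongb_trans.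

Definition tensor : Type := {eq_quot tcongb}.
HB.instance Definition _ := Choice.on tensor.
HB.instance Definition _ := EqQuotient.on tensor.

Definition tcls (s : tterm A1 A2) : tensor := \pi_tensor s.
Definition trep (x : tensor) : tterm A1 A2 := repr x.

Lemma tclsP s t : tcls s = tcls t <-> tcong f1 f2 s t.
Proof.
by split=> [/(@eqmodP _ tcongb_equiv)/asboolP | /asboolP/(@eqmodP _ tcongb_equiv)].
Qed.

Lemma trepK : cancel trep tcls.
Proof. exact: reprK. Qed.

Lemma trep_tcls s : tcong f1 f2 (trep (tcls s)) s.
Proof. by apply/tclsP; rewrite trepK. Qed.

Definition tadd x y := tcls (TenAdd (trep x) (trep y)).
Definition topp x := tcls (TenOpp (trep x)).

Lemma taddE s t : tadd (tcls s) (tcls t) = tcls (TenAdd s t).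
Proof. by apply/tclsP/TCongAdd; exact: trep_tcls. Qed.

Lemma toppE s : topp (tcls s) = tcls (TenOpp s).
Proof. by apply/tclsP/TCongOpp; exact: trep_tcls. Qed.

Fact taddA : associative tadd.
Proof.
move=> x y z; rewrite -[x]trepK -[y]trepK -[z]trepK !taddE.
by apply/tclsP/TaddA.
Qed.

Fact taddC : commutative tadd.
Proof.
by move=> x y; rewrite -[x]trepK -[y]trepK !taddE; apply/tclsP/TaddC.
Qed.

Fact tadd0 : left_id (tcls TenZero) tadd.
Proof. by move=> x; rewrite -[x]trepK taddE; apply/tclsP/Tadd0. Qed.

Fact taddN : left_inverse (tcls TenZero) topp tadd.
Proof. by move=> x; rewrite -[x]trepK toppE taddE; apply/tclsP/TaddN. Qed.

HB.instance Definition _ :=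
  GRing.isZmodule.Build tensor taddA taddC tadd0 taddN.

Lemma tclsD s t : tcls (TenAdd s t) = tcls s + tcls t.
Proof. by rewrite -taddE. Qed.

Lemma tclsN s : tcls (TenOpp s) = - tcls s.
Proof. by rewrite -toppE. Qed.

Definition pure (a : A1) (b : A2) : tensor := tcls (TenPure a b).

Lemma pureDl a a' b : pure (a + a') b = pure a b + pure a' b.
Proof. by rewrite /pure -tclsD; apply/tclsP/TpureDl. Qed.

Lemma pureDr a b b' : pure a (b + b') = pure a b + pure a b'.
Proof. by rewrite /pure -tclsD; apply/tclsP/TpureDr. Qed.

Lemma pure_balanced a u b : pure (a * f1 u) b = pure a (f2 u * b).
Proof. exact/tclsP/Tbalanced. Qed.

Lemma pure0l b : pure 0 b = 0.
Proof. by apply: (addIr (pure 0 b)); rewrite -pureDl !add0r. Qed.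

(* The additive map induced by a map on pure tensors, when it is balanced. *)
Fixpoint teval (M : zmodType) (h : A1 -> A2 -> M) (s : tterm A1 A2) : M :=
  match s with
  | TenZero => 0
  | TenPure a b => h a b
  | TenOpp s => - teval h s
  | TenAdd s t => teval h s + teval h t
  end.

Definition tlift (M : zmodType) (h : A1 -> A2 -> M) (x : tensor) : M :=
  teval h (trep x).

Section TLift.
Variables (M : zmodType) (h : A1 -> A2 -> M).
Hypothesis hDl : forall a a' b, h (a + a') b = h a b + h a' b.
Hypothesis hDr : forall a b b', h a (b + b') = h a b + h a b'.
Hypothesis hB : forall a u b, h (a * f1 u) b = h a (f2 u * b).

Lemma teval_cong s t : tcong f1 f2 s t -> teval h s = teval h t.
Proof.
elim=> //=.
- by move=> u v w _ -> _ ->.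
- by move=> ? ? _ ->.
- by move=> ? ? ? ? _ -> _ ->.
- by move=> *; rewrite addrA.
- by move=> *; rewrite addrC.
- by move=> *; rewrite add0r.
- by move=> *; rewrite addNr.
Qed.

Lemma tlift_tcls s : tlift h (tcls s) = teval h s.
Proof. exact/teval_cong/trep_tcls. Qed.

Lemma tlift_pure a b : tlift h (pure a b) = h a b.
Proof. exact: tlift_tcls. Qed.

Lemma tliftD : {morph tlift h : x y / x + y}.
Proof.
by move=> x y; rewrite -[x]trepK -[y]trepK -tclsD !tlift_tcls.
Qed.

End TLift.

Lemma tensor_ind (P : tensor -> Prop) :
    P 0 -> (forall a b, P (pure a b)) -> (forall x, P x -> P (- x)) ->
    (forall x y, P x -> P y -> P (x + y)) ->
  forall x, P x.
Proof.
move=> P0 Pp PN PD x; rewrite -[x]trepK.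
elim: (trep x) => [|a b|s IHs|s IHs t IHt].
- exact: P0.
- exact: Pp.
- by rewrite tclsN; apply: PN.
- by rewrite tclsD; apply: PD.
Qed.

Definition tscale (u : B) : tensor -> tensor :=
  tlift (fun a b => pure (f1 u * a) b).

Lemma tscale_pure u a b : tscale u (pure a b) = pure (f1 u * a) b.
Proof.
apply: tlift_pure => [*|*|*].
- by rewrite mulrDr pureDl.
- exact: pureDr.
- by rewrite mulrA pure_balanced.
Qed.

Fact tscaleDr : right_distributive tscale +%R.
Proof.
move=> u; apply: tliftD => [*|*|*].
- by rewrite mulrDr pureDl.
- exact: pureDr.
- by rewrite mulrA pure_balanced.
Qed.

Lemma tscale0 u : tscale u 0 = 0.
Proof. by apply: (addIr (tscale u 0)); rewrite -tscaleDr !add0r. Qed.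

Lemma tscaleN u x : tscale u (- x) = - tscale u x.
Proof. by apply: (addIr (tscale u x)); rewrite -tscaleDr !addNr tscale0. Qed.

Fact tscaleA u v x : tscale u (tscale v x) = tscale (u * v) x.
Proof.
elim/tensor_ind: x => [|a b|x IH|x y IHx IHy].
- by rewrite !tscale0.
- by rewrite !tscale_pure rmorphM mulrA.
- by rewrite !tscaleN IH.
- by rewrite !tscaleDr IHx IHy.
Qed.

Fact tscale1 : left_id 1 tscale.
Proof.
elim/tensor_ind => [|a b|x IH|x y IHx IHy].
- by rewrite !tscale0.
- by rewrite !tscale_pure rmorph1 mul1r.
- by rewrite !tscaleN IH.
- by rewrite !tscaleDr IHx IHy.
Qed.

Fact tscaleDl x : {morph tscale^~ x : u v / u + v}.
Proof.
move=> u v; elim/tensor_ind: x => [|a b|x IH|x y IHx IHy] /=.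
- by rewrite !tscale0 addr0.
- by rewrite !tscale_pure rmorphD mulrDl pureDl.
- by rewrite !tscaleN IH opprD.
- by rewrite !tscaleDr IHx IHy addrACA.
Qed.

HB.instance Definition _ := GRing.Zmodule_isLmodule.Build B tensor
  tscaleA tscale1 tscaleDr tscaleDl.

End Tensor.

Arguments pure {B A1 A2 f1 f2}.
Arguments tlift {B A1 A2 f1 f2 M}.

(* The localized ring, as a subring of the field of fractions. *)

Inductive shift_monoid (K : fieldType) (n : nat) : {mpoly K[n]} -> Prop :=
  | ShiftOne : shift_monoid 1
  | ShiftMul p (i j : 'I_n) (a : int) : i != j -> shift_monoid p ->
      shift_monoid (p * ('X_i - 'X_j + a%:~R)).

Section BarU.
Variables (K : fieldType) (n : nat).
Local Notation U := {mpoly K[n]}.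

Definition in_barU : {pred {fraction U}} :=
  fun f => `[< exists p s : U, shift_monoid s /\ f = tofrac p / tofrac s >].

Record barU := BarU { barU_val :> {fraction U}; _ : barU_val \in in_barU }.
HB.instance Definition _ := [isSub for barU_val].
HB.instance Definition _ := [Choice of barU by <:].

Lemma shift_neq0 (i j : 'I_n) (a : int) :
  i != j -> 'X_i - 'X_j + a%:~R != 0 :> U.
Proof.
move=> ij; apply/eqP => /(congr1 (fun p : U => p@_U_(i))).
rewrite mcoeffD mcoeffB !mcoeffX mcoeff0 eqxx.
have -> : (U_(j) == U_(i) :> 'X_{1..n})%MM = false.
  apply/negbTE/eqP => /mnmP/(_ i); rewrite !mnm1E eqxx.
  by rewrite eq_sym (negbTE ij).
have -> : (a%:~R : U)@_U_(i) = 0.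
  rewrite -[a%:~R](rmorph_int (@mpolyC n K)) mcoeffC.
  suff -> : (U_(i) == 0 :> 'X_{1..n})%MM = false by rewrite mulr0.
  by apply/negbTE/eqP => /mnmP/(_ i); rewrite mnm1E eqxx mnm0E.
by rewrite subr0 addr0 => /eqP; rewrite oner_eq0.
Qed.

Lemma shift_monoid_neq0 (s : U) : shift_monoid s -> s != 0.
Proof.
by elim=> [|p i j a ij _ IH]; rewrite ?oner_eq0 // mulf_neq0 ?shift_neq0.
Qed.

Lemma shift_monoidM (s t : U) :
  shift_monoid s -> shift_monoid t -> shift_monoid (s * t).
Proof.
move=> ss; elim=> [|p i j a ij _ IH]; first by rewrite mulr1.
by rewrite mulrA; apply: ShiftMul.
Qed.

Lemma in_barU_frac (p s : U) :
  shift_monoid s -> tofrac p / tofrac s \in in_barU.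
Proof. by move=> ss; apply/asboolP; exists p, s. Qed.

Lemma in_barU_poly (p : U) : tofrac p \in in_barU.
Proof.
by have := in_barU_frac p (ShiftOne K n); rewrite tofrac1 divr1.
Qed.

Fact in_barU_subring : subring_closed in_barU.
Proof.
have nz (s : U) : shift_monoid s -> tofrac s != 0.
  by move=> ss; rewrite tofrac_eq0 shift_monoid_neq0.
split.
- by rewrite -(tofrac1 U) in_barU_poly.
- move=> _ _ /asboolP[p [s [ss ->]]] /asboolP[q [t [st ->]]].
  rewrite -mulNr addf_div ?nz // -tofracN -!tofracM -tofracD.
  exact/in_barU_frac/shift_monoidM.
- move=> _ _ /asboolP[p [s [ss ->]]] /asboolP[q [t [st ->]]].
  rewrite mulf_div -!tofracM.
  exact/in_barU_frac/shift_monoidM.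
Qed.

HB.instance Definition _ := GRing.SubChoice_isSubComNzRing.Build
  {fraction U} in_barU barU in_barU_subring.

Definition polyU (p : U) : barU := BarU (in_barU_poly p).
Definition constU (c : K) : barU := polyU c%:MP.
Definition h (i : 'I_n) : barU := polyU 'X_i.

Definition R_val (i j k l : 'I_n) : {fraction U} :=
  let hij : {fraction U} := tofrac ('X_i - 'X_j) in
  if (k == j) && (l == i) then
    if (i < j)%N then (hij ^+ 2 - 1) / hij ^+ 2 else 1
  else if (k == i) && (l == j) then hij^-1
  else 0.

Fact R_val_in i j k l : R_val i j k l \in in_barU.
Proof.
have sub (a b : 'I_n) : a != b -> shift_monoid ('X_a - 'X_b : U).
  by move=> /(ShiftMul 0)/(_ (ShiftOne K n)); rewrite mul1r addr0.
rewrite /R_val; case: ifP => [_|H1]; last case: ifP => [/andP[/eqP ki /eqP lj]|_].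
- case: ifP => [lt_ij|_]; last by rewrite -(tofrac1 U) in_barU_poly.
  have ij : i != j by rewrite neq_ltn lt_ij.
  rewrite -(tofrac1 U) -tofracXn -tofracB; apply: in_barU_frac.
  by rewrite expr2; apply: shift_monoidM; apply: sub.
- have ij : i != j by apply/eqP => ij; move: H1; rewrite ki lj ij !eqxx.
  by rewrite -[_^-1]mul1r -(tofrac1 U); apply/in_barU_frac/sub.
- by rewrite -(tofrac0 U) in_barU_poly.
Qed.

(* R i j k l has upper indices i j and lower indices k l. *)
Definition R (i j k l : 'I_n) : barU := BarU (R_val_in i j k l).

End BarU.

Arguments constU {K n}.
Arguments h {K n}.
Arguments R {K n}.

(* The defining relations, for families x and d of expressions over an
   arbitrary set of generators.  The rings in question are K-algebras: the
   constants in K commute with the generators. *)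

Section Relations.
Variables (K : fieldType) (n N N' : nat) (G : Type).
Local Notation B := (barU K n).
Variables (x : 'I_n -> 'I_N' -> term B G) (d : 'I_n -> 'I_N -> term B G).
Variable sigma : 'I_n -> 'I_N' -> 'I_N -> B.

Inductive relV : term B G -> term B G -> Prop :=
  | relV_const (c : K) i alpha :
      relV (TCst (constU c) * x i alpha) (x i alpha * TCst (constU c))
  | relV_h i j alpha :
      relV (TCst (h i) * x j alpha) (x j alpha * TCst (h i + (i == j)%:R)%R)
  | relV_R i j alpha beta :
      relV (x i alpha * x j beta)
        (\sum_(k < n) \sum_(l < n) TCst (R i j k l) * x k beta * x l alpha).

Inductive relVs : term B G -> term B G -> Prop :=
  | relVs_const (c : K) j beta :
      relVs (TCst (constU c) * d j beta) (d j beta * TCst (constU c))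
  | relVs_h i j beta :
      relVs (TCst (h i) * d j beta) (d j beta * TCst (h i - (i == j)%:R)%R)
  | relVs_R k l alpha beta :
      relVs (d l alpha * d k beta)
        (\sum_(i < n) \sum_(j < n) d j beta * d i alpha * TCst (R i j k l)).

Inductive relVVs : term B G -> term B G -> Prop :=
  | relVVs_R i j alpha beta :
      relVVs (x i alpha * d j beta)
        ((\sum_(k < n) \sum_(l < n) d k beta * TCst (R k i l j) * x l alpha)
         - TCst ((i == j)%:R * sigma i alpha beta)%R).

End Relations.

Section Rings.
Variables (K : fieldType) (n N N' : nat).
Local Notation B := (barU K n).

Definition xV (i : 'I_n) (alpha : 'I_N') : term B ('I_n * 'I_N') :=
  TGen (i, alpha).
Definition V := presented (relV xV).
HB.instance Definition _ := GRing.PzRing.on V.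
HB.instance Definition _ := GRing.Lmodule.on V.

Definition dVs (j : 'I_n) (beta : 'I_N) : term B ('I_n * 'I_N) :=
  TGen (j, beta).
Definition Vs := presented (relVs dVs).
HB.instance Definition _ := GRing.PzRing.on Vs.
HB.instance Definition _ := GRing.Lmodule.on Vs.

Definition genL : Type := ('I_n * 'I_N') + ('I_n * 'I_N).
Definition xL (i : 'I_n) (alpha : 'I_N') : term B genL := TGen (inl (i, alpha)).
Definition dL (j : 'I_n) (beta : 'I_N) : term B genL := TGen (inr (j, beta)).

Variable sigma : 'I_n -> 'I_N' -> 'I_N -> B.

Definition relL (s t : term B genL) : Prop :=
  [\/ relV xL s t, relVs dL s t | relVVs xL dL sigma s t].

Definition L := presented relL.
HB.instance Definition _ := GRing.PzRing.on L.
HB.instance Definition _ := GRing.Lmodule.on L.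

Definition VtoL : V -> L :=
  lift (cst relL) (fun g : 'I_n * 'I_N' => gen relL (inl g)).
Definition VstoL : Vs -> L :=
  lift (cst relL) (fun g : 'I_n * 'I_N => gen relL (inr g)).

Lemma eval_sum m (G : Type) (A : pzRingType) (f : {rmorphism B -> A})
    (g : G -> A) (F : 'I_m -> term B G) :
  eval f g (\sum_(i < m) F i)%T = \sum_(i < m) eval f g (F i).
Proof.
have e0 : eval f g (TCst 0) = 0 by exact: rmorph0.
by rewrite (big_morph (eval f g) (fun _ _ => erefl) e0).
Qed.

Lemma cls_sum m (F : 'I_m -> term B genL) :
  cls relL (\sum_(i < m) F i)%T = \sum_(i < m) cls relL (F i).
Proof. by rewrite (big_morph _ (@clsD _ _ relL) (erefl 0)). Qed.

Fact VtoL_rel (s t : term B ('I_n * 'I_N')) : relV xV s t ->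
  eval (cst relL) (fun g => gen relL (inl g)) s =
  eval (cst relL) (fun g => gen relL (inl g)) t.
Proof.
case=> [c i a|i j a|i j a b] /=.
- by rewrite -!clsM; apply/clsP/CRel/Or31/relV_const.
- by rewrite -!clsM; apply/clsP/CRel/Or31/relV_h.
- rewrite eval_sum; under eq_bigr do rewrite eval_sum.
  have /CRel/clsP eqR : relL _ _ := Or31 _ _ (relV_R xL i j a b).
  rewrite -clsM eqR.
  rewrite cls_sum; apply: eq_bigr => k _; rewrite cls_sum.
  by apply: eq_bigr => l _; rewrite !clsM.
Qed.

Fact VstoL_rel (s t : term B ('I_n * 'I_N)) : relVs dVs s t ->
  eval (cst relL) (fun g => gen relL (inr g)) s =
  eval (cst relL) (fun g => gen relL (inr g)) t.
Proof.
case=> [c i a|i j a|k l a b] /=.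
- by rewrite -!clsM; apply/clsP/CRel/Or32/relVs_const.
- by rewrite -!clsM; apply/clsP/CRel/Or32/relVs_h.
- rewrite eval_sum; under eq_bigr do rewrite eval_sum.
  have /CRel/clsP eqR : relL _ _ := Or32 _ _ (relVs_R dL k l a b).
  rewrite -clsM eqR.
  rewrite cls_sum; apply: eq_bigr => i _; rewrite cls_sum.
  by apply: eq_bigr => j _; rewrite !clsM.
Qed.

HB.instance Definition _ := GRing.isNmodMorphism.Build V L VtoL
  (lift_is_nmod_morphism VtoL_rel).
HB.instance Definition _ := GRing.isMonoidMorphism.Build V L VtoL
  (lift_is_monoid_morphism VtoL_rel).
HB.instance Definition _ := GRing.isNmodMorphism.Build Vs L VstoL
  (lift_is_nmod_morphism VstoL_rel).
HB.instance Definition _ := GRing.isMonoidMorphism.Build Vs L VstoL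
  (lift_is_monoid_morphism VstoL_rel).

Definition VsV := tensor (cst (relVs dVs)) (cst (relV xV)).
HB.instance Definition _ := GRing.Lmodule.on VsV.

Definition mulVsV : VsV -> L :=
  tlift (fun (a : Vs) (b : V) => VstoL a * VtoL b).

Fact mulVsV_Dl (a a' : Vs) (b : V) :
  VstoL (a + a') * VtoL b = VstoL a * VtoL b + VstoL a' * VtoL b.
Proof. by rewrite raddfD mulrDl. Qed.

Fact mulVsV_Dr (a : Vs) (b b' : V) :
  VstoL a * VtoL (b + b') = VstoL a * VtoL b + VstoL a * VtoL b'.
Proof. by rewrite raddfD mulrDr. Qed.

Fact mulVsV_B (a : Vs) (u : B) (b : V) :
  VstoL (a * cst (relVs dVs) u) * VtoL b =
  VstoL a * VtoL (cst (relV xV) u * b).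
Proof.
rewrite !rmorphM /= /VstoL /VtoL (lift_cst VstoL_rel) (lift_cst VtoL_rel).
by rewrite mulrA.
Qed.

Lemma mulVsV_pure (a : Vs) (b : V) : mulVsV (pure a b) = VstoL a * VtoL b.
Proof. exact: (tlift_pure mulVsV_Dl mulVsV_Dr mulVsV_B). Qed.

Fact mulVsV_is_linear : linear mulVsV.
Proof.
have mD (y z : VsV) : mulVsV (y + z) = mulVsV y + mulVsV z.
  exact: (tliftD mulVsV_Dl mulVsV_Dr mulVsV_B).
have m0 : mulVsV 0 = 0 by apply: (addIr (mulVsV 0)); rewrite -mD !add0r.
have mN (y : VsV) : mulVsV (- y) = - mulVsV y.
  by apply: (addIr (mulVsV y)); rewrite -mD !addNr m0.
move=> u y z; rewrite mD; congr (_ + _); elim/tensor_ind: y => [|a b|y IH|y y' IH IH'].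
- by rewrite scaler0 [mulVsV 0]m0 scaler0.
- rewrite (_ : u *: pure a b = pure (cst (relVs dVs) u * a) b); last first.
    exact: tscale_pure.
  rewrite !mulVsV_pure (rmorphM VstoL) /= {1}/VstoL (lift_cst VstoL_rel).
  by rewrite -mulrA.
- by rewrite scalerN [mulVsV (- (u *: y))]mN IH [mulVsV (- y)]mN scalerN.
- rewrite scalerDr [mulVsV (u *: y + _)]mD [mulVsV (y + _)]mD scalerDr.
  by rewrite IH IH'.
Qed.

HB.instance Definition _ := GRing.isLinear.Build B VsV L *:%R mulVsV
  mulVsV_is_linear.

(* mulVsV is linear, so this says that it is an isomorphism of B-modules. *)
Definition PBW : Prop := bijective (mulVsV : {linear VsV -> L}).

End Rings.

(* Main.v *)
(* The overlaps of the defining relations are x d d and x x d.  The second is the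
   first one read in the opposite ring, with the x's and the derivatives
   exchanged, so only x d d has to be studied.  Writing
   x_i d_jb = \sum_r Phi_ir(d_jb) x_r - (i == j) sigma_ib, the matrices Phi(d_jb)
   satisfy the relations of the d_jb (Yang-Baxter), whatever sigma is; hence the
   two ways of reducing x d d differ by a combination of the d's alone.  If
   multiplication is injective this combination vanishes, and when two different
   Greek indices are available its coefficients say that sigma_i is invariant
   under the shift of h_i and that the shift of sigma_l along h_k is sigma_k.  So
   all sigma_i coincide and are invariant under every shift, hence constant in
   characteristic 0.

   Conversely, for constant sigma the block triangular matrices with diagonal
   blocks Phi and d and off-diagonal block -sigma still satisfy the relations of
   the d's.  So there is a ring morphism from V* to matrices over V*, which
   defines operators x on V* (x) V from the left, and symmetrically operators d
   from the right.  The two families commute, and V* (x) V is generated by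
   1 (x) 1 from the right, which gives the relations between the x operators.  Thus the ring L acts on
   V* (x) V, and acting on 1 (x) 1 inverts the multiplication map. *)

Require Import Defs.
From HB Require Import structures.
From mathcomp Require Import all_boot all_order all_algebra.
From mathcomp Require Import fraction generic_quotient boolp mpoly ring.

Set Implicit Arguments.
Unset Strict Implicit.
Unset Printing Implicit Defensive.

Import GRing.Theory.
Local Open Scope ring_scope.

(** * Shift automorphisms of the localized ring *)

Section BarU.
Variables (K : fieldType) (n : nat).
Local Notation U := {mpoly K[n]}.
Local Notation B := (barU K n).

Lemma barU_frac (u : B) :
  {ps : U * U | shift_monoid ps.2 & val u = tofrac ps.1 / tofrac ps.2}.
Proof.
apply/cid2; case: (asboolP _ (valP u)) => p [s [ss us]].
by exists (p, s).
Qed.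

HB.instance Definition _ :=
  GRing.RMorphism.copy (@barU_val K n) (val : B -> {fraction U}).

Lemma barU_inj : injective (@barU_val K n).
Proof. exact: val_inj. Qed.

Let valD (u v : B) : barU_val (u + v) = barU_val u + barU_val v.
Proof. exact: rmorphD. Qed.
Let valB (u v : B) : barU_val (u - v) = barU_val u - barU_val v.
Proof. exact: rmorphB. Qed.
Let valM (u v : B) : barU_val (u * v) = barU_val u * barU_val v.
Proof. exact: rmorphM. Qed.
Let valN (u : B) : barU_val (- u) = - barU_val u.
Proof. exact: rmorphN. Qed.
Let valX (u : B) m : barU_val (u ^+ m) = barU_val u ^+ m.
Proof. exact: rmorphXn. Qed.
Let val_int a : barU_val (a%:~R : B) = a%:~R.
Proof. exact: rmorph_int. Qed.
Let val0 : barU_val (0 : B) = 0.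
Proof. exact: rmorph0. Qed.
Let val1 : barU_val (1 : B) = 1.
Proof. exact: rmorph1. Qed.

Definition barU_valE := (valD, valB, valM, valN, valX, val_int, val0, val1).

Lemma tofrac_shift_neq0 (s : U) : shift_monoid s -> tofrac s != 0.
Proof. by move=> ss; rewrite tofrac_eq0 shift_monoid_neq0. Qed.

(** A fraction [p / s] is [p] times the inverse of [s], so closure under inverses covers all
    denominators at once. *)
Lemma barU_ind (P : B -> Prop) :
    (forall c, P (constU c)) -> (forall i, P (h i)) ->
    (forall u v, P u -> P v -> P (u + v)) ->
    (forall u v, P u -> P v -> P (u * v)) ->
    (forall u v, u * v = 1 -> P u -> P v) ->
  forall u, P u.
Proof.
move=> Pc Ph PD PM PV u.
have polyUD p q : polyU (p + q) = polyU p + polyU q :> B.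
  by apply: val_inj; rewrite rmorphD /= tofracD.
have polyUM p q : polyU (p * q) = polyU p * polyU q :> B.
  by apply: val_inj; rewrite rmorphM /= tofracM.
have PX m : P (polyU 'X_[m]).
  rewrite mpolyXE_id; apply: (big_ind (fun p => P (polyU p))).
  - by rewrite -mpolyC1; apply: Pc.
  - by move=> p q Pp Pq; rewrite polyUM; apply: PM.
  - move=> i _; elim: (m i) => [|k IH]; first by rewrite expr0 -mpolyC1; apply: Pc.
    by rewrite exprS polyUM; apply: PM (Ph i) IH.
have PP p : P (polyU p).
  elim/mpolyind: p => [|c m p _ _ IH]; first by rewrite -mpolyC0; apply: Pc.
  by rewrite polyUD -mul_mpolyC polyUM; apply: PD IH; apply: PM (Pc c) (PX m).
have [[p s] /= ss us] := barU_frac u.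
pose v : B := BarU (in_barU_frac 1 ss).
have -> : u = polyU p * v.
  by apply: val_inj; rewrite rmorphM /= us tofrac1 mul1r.
apply: PM => //; apply: (PV (polyU s)) => //.
apply: val_inj; rewrite rmorphM rmorph1 /= tofrac1 mul1r mulfV //.
exact: tofrac_shift_neq0.
Qed.

Definition polysh (w : {ffun 'I_n -> int}) : U -> U :=
  comp_mpoly [tuple 'X_i + (w i)%:~R | i < n].

HB.instance Definition _ w := GRing.RMorphism.copy (polysh w)
  (comp_mpoly [tuple 'X_i + (w i)%:~R | i < n]).

Lemma polyshX w i : polysh w 'X_i = 'X_i + (w i)%:~R.
Proof. by rewrite /polysh comp_mpolyXU -tnth_nth tnth_mktuple. Qed.

Lemma polyshC w c : polysh w c%:MP = c%:MP.
Proof. exact: comp_mpolyC. Qed.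

Lemma shift_monoid_polysh w s : shift_monoid s -> shift_monoid (polysh w s).
Proof.
elim=> [|p i j a ij _ IH]; first by rewrite rmorph1; apply: ShiftOne.
rewrite rmorphM rmorphD rmorphB /= !polyshX rmorph_int.
rewrite [X in _ * X](_ : _ = 'X_i - 'X_j + (a + w i - w j)%:~R).
  exact: ShiftMul.
rewrite rmorphB rmorphD /=; ring.
Qed.

Definition sh_val w (u : B) : {fraction U} :=
  let: exist2 ps _ _ := barU_frac u in
  tofrac (polysh w ps.1) / tofrac (polysh w ps.2).

Fact sh_val_in w u : sh_val w u \in @in_barU K n.
Proof.
rewrite /sh_val; case: barU_frac => -[p s] /= ss _.
exact/in_barU_frac/shift_monoid_polysh.
Qed.

(** The value does not depend on the fraction picked by [barU_frac]: equality of fractions is a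
    polynomial identity after cross-multiplication, and [polysh w] preserves it. *)
Lemma sh_valE w u p s : shift_monoid s -> barU_val u = tofrac p / tofrac s ->
  sh_val w u = tofrac (polysh w p) / tofrac (polysh w s).
Proof.
move=> ss us; rewrite /sh_val; case: barU_frac => -[q t] /= st.
rewrite us => /eqP; rewrite eqr_div ?tofrac_shift_neq0 // => /eqP e.
apply/eqP; rewrite eqr_div ?tofrac_shift_neq0 //; try exact: shift_monoid_polysh.
move/eqP: e; rewrite -!tofracM tofrac_eq => /eqP e.
by rewrite -!rmorphM e.
Qed.

Definition sh w (u : B) : B := BarU (sh_val_in w u).

Fact sh_nmod w : nmod_morphism (sh w).
Proof.
split=> [|u v]; apply: val_inj => /=.
  rewrite (@sh_valE w 0 0 1) ?rmorph0 ?mul0r //; first exact: ShiftOne.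
have [[p s] /= ss us] := barU_frac u; have [[q t] /= st vt] := barU_frac v.
have sst := shift_monoidM ss st.
rewrite (sh_valE w ss us) (sh_valE w st vt).
rewrite (@sh_valE w (u + v) (p * t + q * s) (s * t)) //.
  rewrite addf_div ?tofrac_shift_neq0 //; try exact: shift_monoid_polysh.
  by rewrite !rmorphD !rmorphM.
rewrite [LHS]rmorphD /= us vt addf_div ?tofrac_shift_neq0 //.
by rewrite !rmorphD !rmorphM.
Qed.

Fact sh_monoid w : monoid_morphism (sh w).
Proof.
split=> [|u v]; apply: val_inj => /=.
  by rewrite (@sh_valE w 1 1 1) ?rmorph1 ?divr1 //; exact: ShiftOne.
have [[p s] /= ss us] := barU_frac u; have [[q t] /= st vt] := barU_frac v.
have sst := shift_monoidM ss st.
rewrite (sh_valE w ss us) (sh_valE w st vt).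
rewrite (@sh_valE w (u * v) (p * q) (s * t)) //.
  by rewrite mulf_div !rmorphM.
by rewrite [LHS]rmorphM /= us vt mulf_div !rmorphM.
Qed.

HB.instance Definition _ w := GRing.isNmodMorphism.Build B B (sh w) (sh_nmod w).
HB.instance Definition _ w :=
  GRing.isMonoidMorphism.Build B B (sh w) (sh_monoid w).

Lemma sh_polyU w p : sh w (polyU p) = polyU (polysh w p).
Proof.
apply: val_inj; rewrite /= (@sh_valE w (polyU p) p 1) ?rmorph1 ?divr1 //.
exact: ShiftOne.
Qed.

Lemma sh_const w c : sh w (constU c) = constU c.
Proof. by rewrite sh_polyU polyshC. Qed.

Lemma polyU_int (a : int) : polyU a%:~R = a%:~R :> B.
Proof. by apply: val_inj; rewrite [RHS]rmorph_int /= rmorph_int. Qed.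

Lemma sh_h w i : sh w (h i) = h i + (w i)%:~R.
Proof.
rewrite sh_polyU polyshX -polyU_int.
by apply: val_inj; rewrite rmorphD /= tofracD.
Qed.

Lemma barU_rmorph_eq (A : pzRingType) (f g : {rmorphism B -> A}) :
  (forall c, f (constU c) = g (constU c)) -> (forall i, f (h i) = g (h i)) ->
  f =1 g.
Proof.
move=> fgc fgh; elim/barU_ind=> // [u v IHu IHv|u v IHu IHv|u v uv IH].
- by rewrite !rmorphD IHu IHv.
- by rewrite !rmorphM IHu IHv.
(* [A] need not be commutative; inverses are compared by [f v = f v * (f u * g v) = g v]. *)
- rewrite -[LHS]mulr1 -(rmorph1 g) -uv rmorphM -IH mulrA -rmorphM.
  by rewrite (mulrC v) uv rmorph1 mul1r.
Qed.

Lemma shD w w' u : sh w (sh w' u) = sh (w + w') u.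
Proof.
apply: (barU_rmorph_eq (f := sh w \o sh w')) => [c|i] /=.
- by rewrite !sh_const.
- by rewrite !sh_h rmorphD rmorph_int /= sh_h ffunE intrD addrA.
Qed.

Lemma sh0 u : sh 0 u = u.
Proof.
apply: (barU_rmorph_eq (g := idfun)) => [c|i] /=.
- by rewrite sh_const.
- by rewrite sh_h ffunE addr0.
Qed.

End BarU.

(** * The exchange coefficients *)

Lemma inv_shift (F : fieldType) (x : F) :
  x != 0 -> x + 1 != 0 -> x^-1 - (x + 1)^-1 = x^-1 * (x + 1)^-1.
Proof. by move=> x0 x1; field; rewrite x0 x1. Qed.

Lemma inv_three (F : fieldType) (x y z : F) :
    x - y != 0 -> y - z != 0 -> x - z != 0 ->
  (x - y)^-1 * (y - z)^-1 = (x - z)^-1 * ((x - y)^-1 + (y - z)^-1).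
Proof. by move=> xy yz xz; field; rewrite xy yz xz. Qed.

Section ExchangeCoefficients.
Variables (K : fieldType) (n : nat).
Local Notation U := {mpoly K[n]}.
Local Notation B := (barU K n).
Implicit Types (i j k l : 'I_n) (w : {ffun 'I_n -> int}).

(** The weight of a derivative: a coefficient [u] moves from the left of [d_j] to its right as
    [sh (dl j) u]. The same shift occurs when [u] moves from the right of [x_j] to its left, which
    suits the passage to the opposite ring. *)
Definition dl j : {ffun 'I_n -> int} := [ffun i => - (j == i)%:R].

(* 1 / (h_i - h_j), except that [invh i i = 1]; locked against [/=]. *)
Definition invh i j : B := locked (R i j i j).

Lemma invhE i j : R i j i j = invh i j.
Proof. exact: lock. Qed.

Local Notation tX i := (tofrac ('X_i : U)).

Lemma tX_shift_neq0 i j (a : int) : i != j -> tX i - tX j + a%:~R != 0.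
Proof.
move=> ij; rewrite -tofracB -(rmorph_int (@tofrac U)) -tofracD tofrac_eq0.
exact: shift_neq0.
Qed.

Lemma tXB_neq0 i j : i != j -> tX i - tX j != 0.
Proof. by move/(tX_shift_neq0 0); rewrite addr0. Qed.

Lemma invh_id i : invh i i = 1.
Proof. by rewrite -invhE; apply: val_inj; rewrite /= /R_val !eqxx /= ltnn. Qed.

Lemma val_invh i j : i != j -> barU_val (invh i j) = (tX i - tX j)^-1.
Proof.
move=> ij; rewrite -invhE /= /R_val !eqxx (negbTE ij) /=.
by rewrite tofracB.
Qed.

Lemma invh_mul i j : i != j -> invh i j * (h i - h j) = 1.
Proof.
move=> ij; apply: barU_inj; rewrite !barU_valE val_invh //.
by rewrite mulVf ?tXB_neq0.
Qed.

(** Ring morphisms preserve inverses, so it is enough to shift the equation of [invh_mul]. *)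
Lemma val_sh_invh w i j : i != j ->
  barU_val (sh w (invh i j)) = (tX i - tX j + (w i - w j)%:~R)^-1.
Proof.
move=> ij; have nz := tX_shift_neq0 (w i - w j) ij.
have := congr1 (sh w) (invh_mul ij); rewrite rmorphM rmorphB /= !sh_h rmorph1.
move/(congr1 (@barU_val K n)); rewrite !barU_valE => e.
apply: (mulIf nz); rewrite mulVf // -[RHS]e; congr (_ * _).
by rewrite rmorphB /=; ring.
Qed.

Lemma sh_dl_invh_right i j : i != j ->
  invh i j - sh (dl j) (invh i j) = invh i j * sh (dl j) (invh i j).
Proof.
move=> ij; apply: barU_inj; rewrite !barU_valE val_sh_invh // val_invh //.
have := tX_shift_neq0 1 ij.
rewrite !ffunE eqxx (eq_sym j) (negbTE ij) oppr0 sub0r opprK.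
exact: inv_shift (tXB_neq0 ij).
Qed.

Lemma sh_dl_invh_left i j : i != j ->
  sh (dl i) (invh i j) - invh i j = invh i j * sh (dl i) (invh i j).
Proof.
move=> ij; apply: barU_inj; rewrite !barU_valE val_sh_invh // val_invh //.
have nz := tX_shift_neq0 (- 1) ij.
rewrite !ffunE eqxx (negbTE ij) oppr0 subr0 mulrC.
rewrite [(- true%:R)%:~R]mulrN1z in nz *.
have := inv_shift nz; rewrite -addrA addNr addr0.
by apply; apply: tXB_neq0.
Qed.

(** The partial fraction identity behind the Yang-Baxter equation for three different indices. *)
Lemma invh_3 i j k : i != j -> j != k -> i != k ->
  invh i j * invh j k = invh i k * (invh i j + invh j k).
Proof.
move=> ij jk ik; apply: barU_inj; rewrite !barU_valE !val_invh //.
exact: inv_three (tXB_neq0 ij) (tXB_neq0 jk) (tXB_neq0 ik).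
Qed.

(* All that is used of the coefficients R i j j i; unlike their definition, it is
   preserved by transposition. *)
Definition rho_ok (rho : 'I_n -> 'I_n -> B) : Prop :=
  (forall i j, i != j -> rho i j * rho j i = 1 - invh i j ^+ 2) /\
  (forall m i j, m != i -> m != j -> sh (dl m) (rho i j) = rho i j).

Definition rhoR i j : B := locked (R i j j i).

Lemma rhoRE i j : R i j j i = rhoR i j.
Proof. exact: lock. Qed.

Lemma rhoR_invh i j : i != j ->
  rhoR i j = if (i < j)%N then 1 - invh i j ^+ 2 else 1.
Proof.
move=> ij; rewrite -rhoRE; apply: barU_inj.
rewrite /= /R_val !eqxx /=; case: ifP => _; last by rewrite barU_valE.
rewrite !barU_valE val_invh // exprVn -tofracB mulrBl mulfV ?mul1r //.
by rewrite expf_neq0 // tofracB tXB_neq0.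
Qed.

Lemma invh_sym i j : i != j -> invh j i = - invh i j.
Proof.
move=> ij; apply: barU_inj; rewrite barU_valE !val_invh //.
  by rewrite -invrN opprB.
by rewrite eq_sym.
Qed.

Lemma sh_dl_invh m i j : m != i -> m != j -> sh (dl m) (invh i j) = invh i j.
Proof.
move=> mi mj; have [->|ij] := eqVneq i j; first by rewrite invh_id rmorph1.
apply: barU_inj; rewrite val_sh_invh // val_invh //.
by rewrite !ffunE (negbTE mi) (negbTE mj) subrr addr0.
Qed.

Lemma rhoR_ok : rho_ok rhoR.
Proof.
split=> [i j ij|m i j mi mj].
  have ji : j != i by rewrite eq_sym.
  rewrite (rhoR_invh ij) (rhoR_invh ji) (invh_sym ij) sqrrN.
  have := ij; rewrite neq_ltn => /orP[] lt; rewrite lt ltnNge ltnW //=;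
    by rewrite ?mul1r ?mulr1.
have [->|ij] := eqVneq i j; last first.
  rewrite rhoR_invh //; case: ifP => _; last by rewrite rmorph1.
  by rewrite rmorphB rmorph1 rmorphXn /= sh_dl_invh.
by rewrite -rhoRE invhE invh_id rmorph1.
Qed.

Lemma rho_ok_tr rho : rho_ok rho -> rho_ok (fun i j => rho j i).
Proof.
case=> H1 H2; split=> [i j ij|m i j mi mj]; last exact: H2.
by rewrite mulrC H1.
Qed.

End ExchangeCoefficients.

Arguments invh {K n}.
Arguments rhoR {K n}.

(** * Shift invariant elements are constant *)

Section NonzeroPoint.
Variables (K : fieldType) (n : nat).
Local Notation U := {mpoly K[n]}.

Lemma mpoly_rmorph_eq (S : nzRingType) (f g : {rmorphism U -> S}) :
  (forall a, f a%:MP = g a%:MP) -> (forall i, f 'X_i = g 'X_i) -> f =1 g.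
Proof.
move=> fgC fgX; elim/mpolyind=> [|a m p _ _ IH]; first by rewrite !rmorph0.
rewrite -mul_mpolyC !rmorphD !rmorphM IH fgC; congr (_ * _ + _).
rewrite mpolyXE_id !rmorph_prod; apply: eq_bigr => i _.
by rewrite !rmorphXn fgX.
Qed.

(** The variables are specialized one after another. The polynomial stays nonzero, since in a single
    variable over a domain it has only finitely many roots. *)
Lemma nonzero_point (f : 'I_n -> nat -> K) (p : U) :
  (forall i, injective (f i)) -> p != 0 ->
  exists m : 'I_n -> nat, p.@[fun i => f i (m i)] != 0.
Proof.
move=> f_inj p0.
(* The variables in [s] are specialized, the others are kept. *)
pose F (s : seq 'I_n) (m : 'I_n -> nat) i : U :=
  if i \in s then (f i (m i))%:MP else 'X_i.
suff [m pm] : exists m, mmap (@mpolyC n K) (F (enum 'I_n) m) p != 0.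
  exists m; apply: contraNneq pm => pm.
  rewrite -(@mpolyC0 n K) -pm.
  apply/eqP/(@mpoly_rmorph_eq _ (mmap (@mpolyC n K) (F (enum 'I_n) m))
    (@mpolyC n K \o meval _)) => [a|i] /=.
    by rewrite mmapC mevalC.
  by rewrite mmapX mmap1U mevalXU /F mem_enum.
elim: (enum 'I_n) => [|i s [m pm]].
  exists (fun=> 0%N); rewrite (_ : mmap _ _ p = p) //.
  apply: (@mpoly_rmorph_eq _ (mmap _ _) idfun) => [a|i] /=.
    by rewrite mmapC.
  by rewrite mmapX mmap1U.
have [si|si] := boolP (i \in s).
  exists m; rewrite (_ : mmap _ _ p = mmap (@mpolyC n K) (F s m) p) //.
  apply: (@mpoly_rmorph_eq _ (mmap _ _) (mmap _ _)) => [a|j] /=.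
    by rewrite !mmapC.
  by rewrite !mmapX !mmap1U /F inE; case: eqVneq => [->|//]; rewrite si.
set q := mmap _ _ p in pm.
(* [P] is [q] read as a polynomial in ['X_i] over [U]. *)
pose G j : {poly U} := if j == i then 'X else ('X_j)%:P.
pose P := mmap (@polyC U \o @mpolyC n K) G q.
have PX : P.['X_i] = q.
  apply: (@mpoly_rmorph_eq _
    (horner_eval 'X_i \o mmap (@polyC U \o @mpolyC n K) G) idfun) => [a|j] /=.
    by rewrite mmapC /= /horner_eval hornerC.
  rewrite mmapX mmap1U /G /horner_eval; case: eqP => [->|_].
    by rewrite hornerX.
  by rewrite hornerC.
have P0 : P != 0 by apply: contraNneq pm => P0; rewrite -PX P0 horner0.
have [t Pt] : exists t, P.[(f i t)%:MP] != 0.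
  (* By injectivity of [f i] these are [size P] distinct elements, one more than [P] can have
     roots. *)
  pose rs := [seq (f i t)%:MP : U | t <- iota 0 (size P)].
  have /allPn[_ /mapP[t _ ->] ?] : ~~ all (root P) rs.
    apply/negP => Prs; have := max_poly_roots P0 Prs.
    rewrite size_map size_iota ltnn map_inj_uniq ?iota_uniq; first by move/(_ isT).
    by move=> t t' /(can_inj (@mpolyCK n K))/f_inj.
  by exists t.
exists (fun j => if j == i then t else m j).
rewrite (_ : mmap _ _ p = P.[(f i t)%:MP]) //.
apply: (@mpoly_rmorph_eq _ (mmap (@mpolyC n K) _)
  (horner_eval (f i t)%:MP \o
    (mmap (@polyC U \o @mpolyC n K) G \o mmap (@mpolyC n K) (F s m))))
  => [a|j] /=.
  by rewrite !mmapC /horner_eval /= hornerC.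
rewrite !mmapX !mmap1U /F /horner_eval inE.
case: eqVneq => [->|ji] /=.
  by rewrite (negbTE si) mmapX mmap1U /G eqxx hornerX.
case: ifP => _; first by rewrite mmapC /= hornerC.
by rewrite mmapX mmap1U /G (negbTE ji) hornerC.
Qed.

End NonzeroPoint.

Section ShiftInvariants.
Variables (K : fieldType) (n : nat).
Hypothesis charK0 : [pchar K] =i pred0.
Local Notation U := {mpoly K[n]}.
Local Notation B := (barU K n).

Lemma meval_polysh w v (p : U) :
  (polysh w p).@[v] = p.@[fun i => v i + (w i)%:~R].
Proof.
rewrite /polysh comp_mpoly_meval; apply: meval_eq => i.
by rewrite tnth_mktuple mevalD mevalXU -(rmorph_int (@mpolyC n K)) mevalC.
Qed.

(** If [p / s] is invariant, its values at [v0 - m] equal that at [v0] for all natural vectors [m],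
    in cross-multiplied form. Hence [p - (p(v0) / s(v0)) s] vanishes on a grid that is infinite in
    every direction in characteristic 0, and is zero. *)
Lemma sh_invariant_const (u : B) :
  (forall k, sh (dl k) u = u) -> exists a, u = constU a.
Proof.
move=> shu.
(* Iterating the invariance gives the shifts by all [- m] with [m] natural. *)
have shm (m : 'I_n -> nat) : sh [ffun i => - (m i)%:Z] u = u.
  have -> : [ffun i => - (m i)%:Z] = \sum_i dl i *+ m i.
    apply/ffunP => j; rewrite sum_ffunE ffunE (bigD1 j) //= big1 => [|i ij].
      by rewrite addr0 ffunMnE ffunE eqxx mulNrn natz.
    by rewrite ffunMnE ffunE (negbTE ij) oppr0 mul0rn.
  apply: (big_ind (fun w => sh w u = u)) => [|w w' e e'|i _]; first exact: sh0.
    by rewrite -shD e' e.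
  elim: (m i) => [|k IH]; first by rewrite mulr0n sh0.
  by rewrite mulrS -shD IH shu.
have [[p s] /= ss us] := barU_frac u.
have natK_inj : injective (fun t : nat => t%:R : K).
  move=> t t' /= e; wlog tt : t t' e / (t <= t')%N.
    by move=> H; case: (leqP t t') => [|/ltnW] /H; [apply|move=> ->].
  apply/eqP; rewrite eqn_leq tt -subn_eq0 -((pcharf0P K).1 charK0) natrB //.
  by rewrite e subrr eqxx.
have [w0 sw0] := nonzero_point (f := fun=> fun t => t%:R) (fun=> natK_inj)
  (shift_monoid_neq0 ss).
set v0 := (fun i => _) in sw0.
exists (p.@[v0] / s.@[v0]).
have ps : p = (p.@[v0] / s.@[v0]) *: s.
  apply/eqP; rewrite -subr_eq0; apply: contraT => D0.
  have finj i : injective (fun t : nat => v0 i - t%:R).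
    by move=> t t' /addrI/oppr_inj/natK_inj.
  have [m] := nonzero_point finj D0.
  rewrite mevalB mevalZ subr_eq0; case/negP.
  have := sh_valE [ffun i => - (m i)%:Z] ss us.
  have -> : sh_val [ffun i => - (m i)%:Z] u = barU_val u.
    by rewrite -[in RHS](shm m).
  rewrite us => /eqP; rewrite eqr_div ?tofrac_shift_neq0 //; last first.
    exact: shift_monoid_polysh.
  rewrite -!tofracM tofrac_eq => /eqP /(congr1 (meval v0)).
  rewrite !mevalM !meval_polysh.
  set v1 := (fun i => _); set v2 := (fun i => _) => e.
  have v12 : v1 =1 v2 by move=> i; rewrite /v1 /v2 ffunE rmorphN.
  rewrite -!(meval_eq _ v12); apply/eqP/(mulIf sw0).
  by rewrite -e mulrAC mulfVK.
apply: barU_inj; rewrite us /= {1}ps -mul_mpolyC tofracM mulfK //.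
exact: tofrac_shift_neq0.
Qed.

End ShiftInvariants.

(** * The overlap x d d in an arbitrary ring *)

Section ExchangeIdentities.
Variable C : comNzRingType.
Implicit Types e u f g r : C.

(** Lets [ring] use an equation [e = f]: the defect of the goal is exhibited as an explicit multiple
    of [e - f]. *)
Lemma eq_of_defect (x y p e f : C) : e = f -> x - y = p * (e - f) -> x = y.
Proof. by move=> -> /eqP; rewrite subrr mulr0 subr_eq0 => /eqP. Qed.

(** This and the next three are the scalar identities left over in [Phi_rel]: for [i = k] with
    [r = k] and with [r] a third index, then for [i = l] with [r = k] and with [r] a third index. *)
Lemma exchange_identity1 e u r : u - e = e * u -> e * r = r * u + - u * e * r.
Proof. by move=> eu; apply: (eq_of_defect (p := - r) eu); ring. Qed.

Lemma exchange_identity2 e f g r : g * e = f * (g + e) ->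
  f * (r * g) = r * g * e + - e * f * r.
Proof. by move=> efg; apply: (eq_of_defect (p := - r) efg); ring. Qed.

Lemma exchange_identity3 e u : u - e = e * u -> u = u * u + (1 - u ^+ 2) * e.
Proof. by move=> eu; apply: (eq_of_defect (p := 1 - u) eu); ring. Qed.

Lemma exchange_identity4 e f g : g * e = f * (g + e) -> e * g - g * f = f * e.
Proof. by move=> efg; apply: (eq_of_defect (p := 1) efg); ring. Qed.

End ExchangeIdentities.

Section Exchange.
Variables (K : fieldType) (n N : nat).
Local Notation B := (barU K n).
Variable rho : 'I_n -> 'I_n -> B.
Hypothesis rhoP : rho_ok rho.

(* The relations between the derivatives.  The coefficient rho is a parameter so
   that the relations between the x's, read in the opposite ring, are also an
   instance. *)
Definition dual_rel (A : pzRingType) (c : {rmorphism B -> A})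
    (d : 'I_n -> 'I_N -> A) : Prop :=
  [/\ forall u j b, c u * d j b = d j b * c (sh (dl j) u),
      forall k a b, d k a * d k b = d k b * d k a
    & forall k l a b, k != l ->
        d l a * d k b = d l b * d k a * c (invh k l) + d k b * d l a * c (rho l k)].

Variables (A : pzRingType) (c : {rmorphism B -> A}) (d : 'I_n -> 'I_N -> A).
Hypothesis dP : dual_rel c d.

Let cd u j b : c u * d j b = d j b * c (sh (dl j) u).
Proof. by case: dP. Qed.
Let dC k a b : d k a * d k b = d k b * d k a.
Proof. by case: dP. Qed.
Let dR k l a b : k != l ->
  d l a * d k b = d l b * d k a * c (invh k l) + d k b * d l a * c (rho l k).
Proof. by case: dP => _ _; apply. Qed.

(* x_i d_jb = \sum_r Phi j b i r x_r is the mixed relation with sigma = 0. *)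
Definition Phi j b i r : A :=
  if i == j then d r b * c (invh r j)
  else if r == i then d j b * c (rho j i) else 0.

Let dcdc j a u k b v :
  d j a * c u * (d k b * c v) = d j a * d k b * c (sh (dl k) u * v).
Proof. by rewrite rmorphM !mulrA -(mulrA _ (c u)) cd !mulrA. Qed.

(** For [i] different from [l], row [i] of [Phi l a] has only its diagonal entry. *)
Lemma Phi_mul_neq l a k b i r : i != l ->
  \sum_q Phi l a i q * Phi k b q r = d l a * c (rho l i) * Phi k b i r.
Proof.
move=> il; rewrite (bigD1 i) //= big1 => [|q qi]; last first.
  by rewrite {1}/Phi (negbTE il) (negbTE qi) mul0r.
by rewrite addr0 {1}/Phi (negbTE il) eqxx.
Qed.

(** Row [l] of [Phi l a] is full, but among the rows of [Phi k b] only row [k] is; in column [r]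
    only [q = k] and [q = r] survive. *)
Lemma Phi_mul_eq l a k b r :
  \sum_q Phi l a l q * Phi k b q r =
  d k a * d r b * c (sh (dl r) (invh k l) * invh r k) +
  (if r == k then 0 else
   d r a * d k b * c (sh (dl k) (invh r l) * rho k r)).
Proof.
rewrite (bigD1 k) //= {1 2}/Phi !eqxx dcdc; congr (_ + _).
case: eqVneq => [->|rk].
  apply: big1 => q qk.
  by rewrite /Phi !eqxx (negbTE qk) (eq_sym k) (negbTE qk) mulr0.
rewrite (bigD1 r) //= big1 => [|q /andP[qk qr]]; last first.
  by rewrite /Phi (negbTE qk) (eq_sym r) (negbTE qr) mulr0.
by rewrite addr0 /Phi !eqxx (negbTE rk) dcdc.
Qed.

Let shrho m i j : m != i -> m != j -> sh (dl m) (rho i j) = rho i j.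
Proof. by case: rhoP => _; apply. Qed.

Let rhoM i j : i != j -> rho i j * rho j i = 1 - invh i j ^+ 2.
Proof. by case: rhoP => + _; apply. Qed.

(** The exchange relation read backwards: a coefficient that contains the factor [rho k r] allows
    this without division. It brings all products to the order [d k], [d r]. *)
Let dR_rev r k a b v : r != k ->
  d r b * d k a * c (v * rho k r) =
  d k a * d r b * c v - d k b * d r a * c (invh r k * v).
Proof.
move=> rk; rewrite mulrC rmorphM (dR a b rk) mulrDl addrC.
by rewrite -!(mulrA _ (c _)) -!rmorphM addKr.
Qed.

(** Once both sides of an equation are combinations of the same two monomials, [congr] leaves one
    commutative identity per monomial. *)
Definition lincomb2 (P Q : A) (u v : B) := P * c u + Q * c v.
Let lcl P Q u : P * c u = lincomb2 P Q u 0.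
Proof. by rewrite /lincomb2 rmorph0 mulr0 addr0. Qed.
Let lcr P Q u : Q * c u = lincomb2 P Q 0 u.
Proof. by rewrite /lincomb2 rmorph0 mulr0 add0r. Qed.
Let lcD P Q u v u' v' :
  lincomb2 P Q u v + lincomb2 P Q u' v' = lincomb2 P Q (u + u') (v + v').
Proof. by rewrite /lincomb2 !rmorphD !mulrDr addrACA. Qed.
Let lcN P Q u v : - lincomb2 P Q u v = lincomb2 P Q (- u) (- v).
Proof. by rewrite /lincomb2 !rmorphN !mulrN opprD. Qed.
Let lcM P Q u v w : lincomb2 P Q u v * c w = lincomb2 P Q (u * w) (v * w).
Proof. by rewrite /lincomb2 !rmorphM mulrDl !mulrA. Qed.

Let sh_rhoM w i j : i != j ->
  sh w (rho i j) * sh w (rho j i) = 1 - sh w (invh i j) ^+ 2.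
Proof. by move=> ij; rewrite -rmorphM rhoM // rmorphB rmorph1 rmorphXn. Qed.

Lemma Phi_comm k a b i r :
  \sum_q Phi k a i q * Phi k b q r = \sum_q Phi k b i q * Phi k a q r.
Proof.
have [->|ik] := eqVneq i k; last first.
  rewrite !Phi_mul_neq // /Phi (negbTE ik); case: eqVneq => _;
    last by rewrite !mulr0.
  by rewrite !dcdc dC.
rewrite !Phi_mul_eq; case: eqVneq => [->|rk]; first by rewrite !addr0 dC.
rewrite invh_id rmorph1 !mul1r !dR_rev //.
set P := d k a * d r b; set Q := d k b * d r a.
rewrite !(lcl P Q) !(lcr P Q) !(lcD, lcN) -sh_dl_invh_right //.
by rewrite !(subr0, sub0r, opprB, add0r, addrC (invh r k)) !subrK.
Qed.

(* With [Phi_comm], the Yang-Baxter part of the overlap x d d. *)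
Lemma Phi_rel k l a b i r : k != l ->
  \sum_q Phi l a i q * Phi k b q r =
  (\sum_q Phi l b i q * Phi k a q r) * c (sh (dl r) (invh k l)) +
  (\sum_q Phi k b i q * Phi l a q r) * c (sh (dl r) (rho l k)).
Proof.
move=> kl; have lk : l != k by rewrite eq_sym.
(* In row [l] the first factor of the last product is diagonal, those of the other two products are
   full. *)
have [->|il] := eqVneq i l.
  rewrite [in X in _ = _ + X]Phi_mul_neq // !Phi_mul_eq {1}/Phi eqxx dcdc.
  case: eqVneq => [->|rk].
    rewrite !addr0 !(dC k b a) !invh_id -!(mulrA _ (c _)) -!rmorphM -mulrDr.
    rewrite -rmorphD; congr (_ * c _).
    rewrite !mulr1 [X in _ + X]mulrAC sh_rhoM //.
    exact/exchange_identity3/sh_dl_invh_left.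
  have [->|rl] := eqVneq r l.
    rewrite invh_id rmorph1 !dR_rev //.
    set P := d k a * d l b; set Q := d k b * d l a.
    rewrite !(lcl P Q) !(lcr P Q) !(lcD, lcN, lcM, lcD).
    rewrite (invh_sym _ kl). rewrite !(mulr1, mul1r) sh_rhoM //.
    rewrite !(add0r, addr0, mul0r, subr0, sub0r, opprK, mul1r, mulr1).
    have E : sh (dl l) (invh k l) * - invh k l + invh k l =
             sh (dl l) (invh k l) :> B.
      by rewrite mulrN mulrC -sh_dl_invh_right // opprB subrK.
    by rewrite E; congr lincomb2; rewrite -expr2 addrC subrK.
  rewrite !(sh_dl_invh, shrho) ?dR_rev // 1?eq_sym //.
  set P := d k a * d r b; set Q := d k b * d r a.
  rewrite !(lcl P Q) !(lcr P Q) !(lcD, lcN, lcM, lcD).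
  rewrite !(add0r, addr0, mul0r, subr0, sub0r, opprK, mul1r, mulr1).
  rewrite (exchange_identity4 (invh_3 _ rk kl rl)); congr lincomb2.
  by rewrite [X in _ + X]mulrAC rhoM // mulrBl mul1r -mulrA -expr2 mulrC addrC subrK.
have [->|ik] := eqVneq i k; last first.
  (* Outside rows [k] and [l] everything is diagonal, and the claim is the exchange relation
     multiplied by [rho l i * rho k i]. *)
  rewrite !Phi_mul_neq // /Phi (negbTE ik) (negbTE il).
  have [->|ri] := eqVneq r i; last by rewrite !mulr0 !mul0r addr0.
  rewrite !dcdc !(sh_dl_invh, shrho) // 1?eq_sym //.
  rewrite (dR a b kl) mulrDl -!(mulrA _ (c _)) -!rmorphM.
  by congr (_ * c _ + _ * c _); ring.
rewrite [in LHS]Phi_mul_neq // [X in X * _ + _]Phi_mul_neq //.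
rewrite Phi_mul_eq /Phi eqxx !dcdc.
have [->|rk] := eqVneq r k.
  rewrite (dR a b kl) invh_id.
  set P := d l b * d k a; set Q := d k b * d l a.
  rewrite (negbTE kl) !(lcl P Q) !(lcr P Q) !(lcD, lcN, lcM, lcD).
  rewrite !(add0r, addr0, mul0r, subr0, sub0r, opprK, mul1r, mulr1).
  rewrite rmorph1 mul1r (invh_sym _ kl) rmorphN /=; congr lincomb2.
  exact/exchange_identity1/sh_dl_invh_left.
have [->|rl] := eqVneq r l.
  rewrite addr0 (dC l b a) invh_id -!(mulrA _ (c _)) -!rmorphM -mulrDr -rmorphD.
  congr (_ * c _).
  rewrite mulr1 (invh_sym _ lk) rmorphN /= mulrN -mulrA.
  by rewrite -sh_dl_invh_left // mulrBr opprB [X in _ + X]mulrC subrK.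
have [lr kr] : l != r /\ k != r by rewrite ![_ == r]eq_sym.
rewrite !(sh_dl_invh, shrho) //.
rewrite (dR a b rl).
set P := d l b * d r a; set Q := d r b * d l a.
rewrite !(lcl P Q) !(lcr P Q) !(lcD, lcN, lcM, lcD).
rewrite !(add0r, addr0, mul0r, subr0, sub0r, opprK, mul1r, mulr1).
rewrite (invh_sym _ kl); congr lincomb2; last by rewrite mulrA mulrC mulrA.
exact: exchange_identity2 (invh_3 _ rk kl rl).
Qed.

End Exchange.

(** * Block triangular matrices encoding the mixed relation *)

Section ShiftedDiagonal.
Variables (K : fieldType) (n m : nat).
Local Notation B := (barU K n).
Variables (A : pzRingType) (c : {rmorphism B -> A}).
Variable w : 'I_m -> {ffun 'I_n -> int}.

(** How a coefficient passes a column [y] whose entries have weights [w i]: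
    [y_i u = (sh (w i) u) y_i], hence a diagonal matrix. *)
Definition shdiag (u : B) : 'M[A]_m :=
  \matrix_(i, j) if i == j then c (sh (w i) u) else 0.

Lemma mul_mx_shdiag (X : 'M[A]_m) u i j :
  (X * shdiag u) i j = X i j * c (sh (w j) u).
Proof.
rewrite mxE (bigD1 j) //= big1 => [|q qj]; last by rewrite mxE (negbTE qj) mulr0.
by rewrite addr0 mxE eqxx.
Qed.

Lemma mul_shdiag_mx (X : 'M[A]_m) u i j :
  (shdiag u * X) i j = c (sh (w i) u) * X i j.
Proof.
rewrite mxE (bigD1 i) //= big1 => [|q qi]; last first.
  by rewrite mxE eq_sym (negbTE qi) mul0r.
by rewrite addr0 mxE eqxx.
Qed.

Fact shdiag_nmod : nmod_morphism shdiag.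
Proof.
by split=> [|u v]; apply/matrixP => i j; rewrite !mxE; case: eqP;
  rewrite ?(rmorph0, addr0) // !rmorphD.
Qed.

Fact shdiag_monoid : monoid_morphism shdiag.
Proof.
split=> [|u v]; apply/matrixP => i j.
  by rewrite !mxE; case: eqP; rewrite ?rmorph1.
rewrite mul_mx_shdiag !mxE; case: eqP => [->|_]; last by rewrite mul0r.
by rewrite !rmorphM.
Qed.

HB.instance Definition _ :=
  GRing.isNmodMorphism.Build B 'M[A]_m shdiag shdiag_nmod.
HB.instance Definition _ :=
  GRing.isMonoidMorphism.Build B 'M[A]_m shdiag shdiag_monoid.

End ShiftedDiagonal.

Section Bordered.
Variables (K : fieldType) (n N : nat).
Local Notation B := (barU K n).
Variable rho : 'I_n -> 'I_n -> B.
Hypothesis rhoP : rho_ok rho.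
Variables (A : pzRingType) (c : {rmorphism B -> A}) (d : 'I_n -> 'I_N -> A).
Hypothesis dP : dual_rel rho c d.

(** Index [ord0] stands for the entry 1, of weight 0; the lifted indices stand for the x's. *)
Definition bshift (I : 'I_n.+1) : {ffun 'I_n -> int} :=
  if unlift ord0 I is Some i then dl i else 0.

Local Notation bcst := (shdiag c bshift).

Variable sigma : 'I_n -> 'I_N -> B.

(* The coefficients in y_I d_jb = \sum_J (bgen j b)_IJ y_J, for y_0 = 1 and
   y_(lift ord0 i) = x_i, when x_i d_jb is rewritten by the mixed relation. *)
Definition bgen j b : 'M[A]_n.+1 :=
  \matrix_(I, J) match unlift ord0 I, unlift ord0 J with
    | Some i, Some r => Phi rho c d j b i r
    | Some i, None => if i == j then - c (sigma i b) else 0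
    | None, Some r => 0
    | None, None => d j b
    end.

Lemma bgen00 j b : bgen j b ord0 ord0 = d j b.
Proof. by rewrite mxE unlift_none. Qed.
Lemma bgen0S j b r : bgen j b ord0 (lift ord0 r) = 0.
Proof. by rewrite mxE unlift_none liftK. Qed.
Lemma bgenS0 j b i :
  bgen j b (lift ord0 i) ord0 = if i == j then - c (sigma i b) else 0.
Proof. by rewrite mxE unlift_none liftK. Qed.
Lemma bgenSS j b i r :
  bgen j b (lift ord0 i) (lift ord0 r) = Phi rho c d j b i r.
Proof. by rewrite mxE !liftK. Qed.

Lemma bgenM00 l a k b : (bgen l a * bgen k b) ord0 ord0 = d l a * d k b.
Proof.
rewrite mxE big_ord_recl !bgen00 big1 ?addr0 // => q _.
by rewrite bgen0S mul0r.
Qed.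
Lemma bgenM0S l a k b r : (bgen l a * bgen k b) ord0 (lift ord0 r) = 0.
Proof.
rewrite mxE big_ord_recl bgen0S mulr0 big1 ?addr0 // => q _.
by rewrite bgen0S mul0r.
Qed.
Lemma bgenMSS l a k b i r : (bgen l a * bgen k b) (lift ord0 i) (lift ord0 r) =
  \sum_q Phi rho c d l a i q * Phi rho c d k b q r.
Proof.
rewrite mxE big_ord_recl bgen0S mulr0 add0r.
by apply: eq_bigr => q _; rewrite !bgenSS.
Qed.
Lemma bgenMS0 l a k b i : (bgen l a * bgen k b) (lift ord0 i) ord0 =
  - ((if i == l then c (sigma i a) * d k b else 0) +
     Phi rho c d l a i k * c (sigma k b)).
Proof.
rewrite mxE big_ord_recl bgen00 bgenS0 (bigD1 k) //= big1 => [|q qk]; last first.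
  by rewrite bgenSS bgenS0 (negbTE qk) mulr0.
rewrite bgenSS bgenS0 eqxx addr0 mulrN opprD.
by case: eqP; rewrite ?mulNr // mul0r oppr0.
Qed.

Lemma bshift0 : bshift ord0 = 0.
Proof. by rewrite /bshift unlift_none. Qed.
Lemma bshiftS i : bshift (lift ord0 i) = dl i.
Proof. by rewrite /bshift liftK. Qed.

Lemma ord_lift_cases (P : 'I_n.+1 -> Prop) :
  P ord0 -> (forall i, P (lift ord0 i)) -> forall I, P I.
Proof. by move=> P0 PS I; case: (unliftP ord0 I) => [i|] ->. Qed.

Let cd u j b : c u * d j b = d j b * c (sh (dl j) u).
Proof. by case: dP. Qed.

Lemma bgen_cst u j b : bcst u * bgen j b = bgen j b * bcst (sh (dl j) u).
Proof.
apply/matrixP => I J; rewrite mul_shdiag_mx mul_mx_shdiag.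
elim/ord_lift_cases: I => [|i]; elim/ord_lift_cases: J => [|r].
- by rewrite bgen00 bshift0 !sh0 cd.
- by rewrite bgen0S mulr0 mul0r.
- rewrite bgenS0 bshift0 bshiftS sh0.
  case: eqVneq => [->|_]; last by rewrite mulr0 mul0r.
  by rewrite mulrN mulNr -!rmorphM mulrC.
- rewrite bgenSS !bshiftS shD /Phi; case: eqVneq => [->|_].
    by rewrite mulrA cd shD -!mulrA -!rmorphM mulrC.
  case: eqVneq => [->|_]; last by rewrite mulr0 mul0r.
  by rewrite mulrA cd shD addrC -!mulrA -!rmorphM mulrC.
Qed.

(** Only the bottom left block contains [sigma]. The diagonal blocks satisfy the relation by
    [dual_rel] and [Phi_rel], and the top right block is zero. *)
Lemma bgen_rel_iff k l a b : k != l ->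
  bgen l a * bgen k b = bgen l b * bgen k a * bcst (invh k l) +
                        bgen k b * bgen l a * bcst (rho l k) <->
  forall i, (bgen l a * bgen k b) (lift ord0 i) ord0 =
   (bgen l b * bgen k a) (lift ord0 i) ord0 * c (invh k l) +
   (bgen k b * bgen l a) (lift ord0 i) ord0 * c (rho l k).
Proof.
move=> kl; split=> [E i|E].
  by rewrite {}E [LHS]mxE !mul_mx_shdiag bshift0 !sh0.
apply/matrixP => I J; rewrite [RHS]mxE !mul_mx_shdiag.
elim/ord_lift_cases: I => [|i]; elim/ord_lift_cases: J => [|r].
- by rewrite !bgenM00 bshift0 !sh0; case: dP => _ _ ->.
- by rewrite !bgenM0S !mul0r addr0.
- by rewrite bshift0 !sh0.
- by rewrite !bgenMSS bshiftS Phi_rel.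
Qed.

Lemma bgen_comm k a b :
    (forall b', sh (dl k) (sigma k b') = sigma k b') ->
  bgen k a * bgen k b = bgen k b * bgen k a.
Proof.
move=> sk; apply/matrixP => I J.
elim/ord_lift_cases: I => [|i]; elim/ord_lift_cases: J => [|r].
- by rewrite !bgenM00; case: dP.
- by rewrite !bgenM0S.
- rewrite !bgenMS0 /Phi; case: eqVneq => [->|ik].
    by rewrite invh_id rmorph1 !mulr1 !cd !sk addrC.
  by rewrite !mul0r.
- by rewrite !bgenMSS Phi_comm.
Qed.

(** In the bottom left column the terms match because [sigma] does not depend on its Latin index and
    passes the derivatives unchanged. *)
Lemma bgen_dual_rel :
    (forall i k b, sigma i b = sigma k b) ->
    (forall i k b, sh (dl k) (sigma i b) = sigma i b) ->
  dual_rel rho bcst bgen.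
Proof.
move=> sC sS; split=> [u j b|k a b|k l a b kl].
- exact: bgen_cst.
- exact: bgen_comm.
apply/bgen_rel_iff => // i; rewrite !bgenMS0 /Phi.
case: (eqVneq i l) kl => [->|il] kl.
  rewrite (eq_sym l) (negbTE kl) !(sC k l) add0r !cd !sS.
  rewrite !mulNr -opprD; congr (- _).
  rewrite mulrDl -!(mulrA _ (c _)) -!rmorphM -addrA -mulrDr -rmorphD addrC.
  have := rhoP.1 _ _ kl => rkl.
  congr (_ * c _ + _ * c _); last by rewrite mulrC.
  (* The total coefficient of [d k b] on the right is [sigma] times
     [invh k l ^+ 2 + rho k l * rho l k], which is 1. *)
  by rewrite mulrCA (mulrCA (rho k l)) rkl -expr2 -mulrDr addrC subrK mulr1.
case: (eqVneq i k) => [->|ik].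
  (* The two terms in [d l b] on the right cancel, since [invh] is antisymmetric. *)
  rewrite !add0r !mulNr -opprD !(sC l k) cd sS (invh_sym _ kl).
  rewrite mulrDl -!(mulrA _ (c _)) -!rmorphM addrCA -mulrDr -rmorphD.
  congr (- _); rewrite -[LHS]addr0; congr (_ * c _ + _); first by rewrite mulrC.
  by rewrite -[LHS](mulr0 (d l b)) -(rmorph0 c); congr (_ * c _); ring.
by rewrite !mul0r addr0 oppr0 !mul0r addr0.
Qed.

Variable x : 'I_n -> A.
Hypothesis xc : forall i u, x i * c u = c (sh (dl i) u) * x i.
Hypothesis xd : forall i j b,
  x i * d j b = \sum_r Phi rho c d j b i r * x r -
                (if i == j then c (sigma i b) else 0).

Definition xcol : 'cV[A]_n.+1 :=
  \col_I if unlift ord0 I is Some i then x i else 1.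

(** In this matrix form of the mixed relation, reducing [x d d] amounts to multiplying two
    matrices. *)
Lemma xcol_bgen j b : xcol *m (d j b)%:M = bgen j b *m xcol.
Proof.
apply/matrixP => I [[|//] o]; rewrite !mxE big_ord1 !mxE big_ord_recl /=.
elim/ord_lift_cases: I => [|i].
  rewrite unlift_none mul1r bgen00 !mxE unlift_none mulr1.
  by rewrite big1 ?addr0 // => q _; rewrite bgen0S mul0r.
rewrite liftK xd bgenS0 !mxE unlift_none mulr1 addrC; congr (_ + _).
  by case: eqP; rewrite ?oppr0.
by apply: eq_bigr => q _; rewrite bgenSS mxE liftK.
Qed.

Lemma mulmx_xcol (M : 'M[A]_n.+1) I :
  (M *m xcol) I ord0 = M I ord0 + \sum_r M I (lift ord0 r) * x r.
Proof.
rewrite mxE big_ord_recl mxE unlift_none mulr1; congr (_ + _).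
by apply: eq_bigr => r _; rewrite mxE liftK.
Qed.

Lemma x_dd i l a k b : x i * (d l a * d k b) =
  (bgen l a * bgen k b) (lift ord0 i) ord0 +
  \sum_r (bgen l a * bgen k b) (lift ord0 i) (lift ord0 r) * x r.
Proof.
rewrite -mulmx_xcol -mulmxA -xcol_bgen mulmxA -xcol_bgen -mulmxA.
by rewrite !mxE !big_ord1 !mxE !big_ord1 !mxE liftK !mulr1n.
Qed.

Lemma x_ddc i l a k b u : x i * (d l a * d k b * c u) =
  (bgen l a * bgen k b * bcst u) (lift ord0 i) ord0 +
  \sum_r (bgen l a * bgen k b * bcst u) (lift ord0 i) (lift ord0 r) * x r.
Proof.
rewrite mulrA x_dd mulrDl mulr_suml; congr (_ + _).
  by rewrite mul_mx_shdiag bshift0 sh0.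
by apply: eq_bigr => r _; rewrite mul_mx_shdiag bshiftS -!mulrA xc.
Qed.

(** By [Phi_comm] the two reductions have the same part linear in the x's; cancelling it leaves the
    [sigma] column. The next lemma does the same with [Phi_rel]. *)
Lemma bgen_comm_defect k a b :
  (bgen k a * bgen k b) (lift ord0 k) ord0 =
  (bgen k b * bgen k a) (lift ord0 k) ord0.
Proof.
have : x k * (d k a * d k b) = x k * (d k b * d k a) by case: dP => _ -> _.
rewrite !x_dd; under eq_bigr do rewrite bgenMSS Phi_comm // -bgenMSS.
exact: addIr.
Qed.

Lemma bgen_rel_defect i k l a b : k != l ->
  (bgen l a * bgen k b) (lift ord0 i) ord0 =
   (bgen l b * bgen k a) (lift ord0 i) ord0 * c (invh k l) +
   (bgen k b * bgen l a) (lift ord0 i) ord0 * c (rho l k).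
Proof.
move=> kl; have := congr1 ( *%R (x i)) ((let: And3 _ _ e := dP in e) k l a b kl).
rewrite mulrDr x_dd !x_ddc addrACA !mul_mx_shdiag bshift0 !sh0 -big_split /=.
under eq_bigr do rewrite bgenMSS Phi_rel //.
under [X in _ = _ + X -> _]eq_bigr do
  rewrite !mul_mx_shdiag -mulrDl !bgenMSS bshiftS.
exact: addIr.
Qed.

Hypothesis d_free : forall k a b u v, a != b ->
  d k a * c u + d k b * c v = 0 -> u = 0.

Lemma d_free2 k a b u v u' v' : a != b ->
  d k a * c u + d k b * c v = d k a * c u' + d k b * c v' -> u = u'.
Proof.
move=> ab e; apply/eqP; rewrite -subr_eq0; apply/eqP.
apply: (d_free (k := k) (v := v - v') ab).
by rewrite !rmorphB !mulrBr addrACA -opprD e subrr.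
Qed.

(** Compares the coefficients of [d k a] in the defect. *)
Lemma sigma_shift k a b : a != b -> sh (dl k) (sigma k b) = sigma k b.
Proof.
move=> ab; have := bgen_comm_defect k a b.
rewrite !bgenMS0 eqxx /Phi eqxx invh_id rmorph1 !mulr1 !cd => /oppr_inj.
by rewrite addrC => /(d_free2 ab).
Qed.

(** Compares the coefficients of [d k a] in row [l] of the defect. Both contain the factor
    [invh k l], which is cancelled by means of its inverse [h k - h l]. *)
Lemma sigma_shift_neq k l a b : a != b -> k != l ->
  sh (dl k) (sigma l b) = sigma k b.
Proof.
move=> ab kl; have := bgen_rel_defect l a b kl.
rewrite !bgenMS0 /Phi eqxx (eq_sym l) (negbTE kl) add0r !cd !mulNr -opprD.
move=> /oppr_inj; rewrite mulrDl -!(mulrA _ (c _)) -!rmorphM addrC -addrA.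
rewrite -mulrDr -rmorphD => /(d_free2 ab) e.
rewrite -[LHS]mul1r -[RHS]mul1r -(invh_mul _ kl) ![invh k l * _]mulrC -!mulrA.
by congr (_ * _); rewrite e mulrC.
Qed.

(** Both sides have the same image under the invertible shift along [dl k]. *)
Lemma sigma_eq k l a b : a != b -> sigma k b = sigma l b.
Proof.
have [->//|kl] := eqVneq k l => ab.
rewrite -[LHS]sh0 -[RHS]sh0 -(addNr (dl k)) -!shD (sigma_shift_neq ab kl).
by rewrite (sigma_shift _ ab).
Qed.

Lemma sigma_const : [pchar K] =i pred0 -> (0 < n)%N -> (1 < N)%N ->
  exists s : 'I_N -> K, forall i b, sigma i b = constU (s b).
Proof.
move=> charK0 n0 N1.
suff /choice[s Hs] : forall b, exists a, forall i, sigma i b = constU a.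
  by exists s => i b.
move=> b; have [a ab] : exists a, a != b.
  have [b0|b0] := eqVneq b (Ordinal (ltnW N1)); last first.
    by exists (Ordinal (ltnW N1)); rewrite eq_sym.
  by exists (Ordinal N1); rewrite b0.
have [|s Hs] := @sh_invariant_const K n charK0 (sigma (Ordinal n0) b).
  move=> k; rewrite (sigma_eq _ k ab); exact: sigma_shift ab.
by exists s => i; rewrite (sigma_eq i (Ordinal n0) ab).
Qed.

End Bordered.

(** * Presentations *)

Section Rsums.
Variables (K : fieldType) (n : nat).
Local Notation B := (barU K n).
Variables (A : pzRingType) (c : {rmorphism B -> A}).

Lemma R_cases i j k l : R i j k l =
  if (k == j) && (l == i) then rhoR i j
  else if (k == i) && (l == j) then invh i j else 0 :> B.
Proof.
case: ifP => [/andP[/eqP-> /eqP->]|N]; first by rewrite -rhoRE.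
case: ifP => [/andP[/eqP ki /eqP lj]|N']; first by rewrite ki lj -invhE.
by apply: barU_inj; rewrite barU_valE /= /R_val N N'.
Qed.

Lemma sum2_supp (F : 'I_n -> 'I_n -> A) k l :
    (forall i j, ~~ ((i == k) && (j == l)) -> ~~ ((i == l) && (j == k)) ->
     F i j = 0) ->
  \sum_i \sum_j F i j = if k == l then F k k else F k l + F l k.
Proof.
move=> F0; rewrite pair_big /=; case: eqVneq => [<-|kl] in F0 *.
  rewrite (bigD1 (k, k)) //= big1 ?addr0 // => -[i j] /= ij.
  by apply: F0; apply: contra ij => /andP[/eqP-> /eqP->].
rewrite (bigD1 (k, l)) //= (bigD1 (l, k)) /=; last first.
  by rewrite xpair_eqE (negbTE kl) andbF.
rewrite big1 ?addr0 // => -[i j] /= /andP[ij ji].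
by apply: F0; [apply: contra ij|apply: contra ji] => /andP[/eqP-> /eqP->].
Qed.

Lemma sum_R_lower (F : 'I_n -> 'I_n -> A) k l :
  \sum_i \sum_j F i j * c (R i j k l) =
  if k == l then F k k else F k l * c (invh k l) + F l k * c (rhoR l k).
Proof.
rewrite (sum2_supp (k := k) (l := l)) => [|i j N1 N2]; last first.
  rewrite R_cases (eq_sym k j) (eq_sym l i) andbC (negbTE N2).
  by rewrite (eq_sym k i) (eq_sym l j) (negbTE N1) rmorph0 mulr0.
case: eqVneq => [->|kl].
  by rewrite R_cases !eqxx -rhoRE invhE invh_id rmorph1 mulr1.
by rewrite !R_cases !eqxx (negbTE kl).
Qed.

Lemma sum_R_upper (F : 'I_n -> 'I_n -> A) i j :
  \sum_k \sum_l c (R i j k l) * F k l =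
  if i == j then F i i else c (invh i j) * F i j + c (rhoR i j) * F j i.
Proof.
rewrite (sum2_supp (k := i) (l := j)) => [|k l N1 N2]; last first.
  by rewrite R_cases (negbTE N1) (negbTE N2) rmorph0 mul0r.
case: eqVneq => [->|ij].
  by rewrite R_cases !eqxx -rhoRE invhE invh_id rmorph1 mul1r.
by rewrite !R_cases !eqxx (negbTE ij) (eq_sym j) (negbTE ij).
Qed.

(** Brings the mixed relation into the form in which the overlaps were computed. *)
Lemma sum_R_Phi (N : nat) (d : 'I_n -> 'I_N -> A) (x : 'I_n -> A) i j b :
  \sum_k \sum_l d k b * c (R k i l j) * x l =
  \sum_r Phi rhoR c d j b i r * x r.
Proof.
rewrite exchange_big /=; apply: eq_bigr => r _; rewrite /Phi.
case: eqVneq => [->|ij].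
  rewrite (bigD1 r) //= big1 => [|k kr].
    rewrite R_cases !eqxx addr0 /=; case: eqVneq => [->|//].
    by rewrite -rhoRE invhE.
  rewrite R_cases eqxx andbT (eq_sym r k) (negbTE kr).
  case: andP => [[rj jk]|_]; last by rewrite rmorph0 mulr0 mul0r.
  by case/eqP: kr; rewrite (eqP rj) (eqP jk).
case: eqVneq => [->|ri].
  rewrite (bigD1 j) //= big1 => [|k kj].
    by rewrite R_cases !eqxx addr0.
  rewrite R_cases (eq_sym j k) (negbTE kj) andbF (eq_sym j i) (negbTE ij) andbF.
  by rewrite rmorph0 mulr0 mul0r.
rewrite big1 ?mul0r // => k _.
by rewrite R_cases (negbTE ri) (eq_sym j i) (negbTE ij) !andbF rmorph0 mulr0 mul0r.
Qed.

End Rsums.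

(** * The opposite ring and the defining relations *)

Section Converse.
Variables (K : fieldType) (n : nat).
Local Notation B := (barU K n).
Variables (A : pzRingType) (c : {rmorphism B -> A}).

Definition conv (u : B) : A^c := c u.

Fact conv_nmod : nmod_morphism conv.
Proof. by split=> [|u v]; rewrite /conv ?rmorph0 ?rmorphD. Qed.

Fact conv_monoid : monoid_morphism conv.
Proof. by split=> [|u v]; rewrite /conv ?rmorph1 // mulrC rmorphM. Qed.

HB.instance Definition _ := GRing.isNmodMorphism.Build B A^c conv conv_nmod.
HB.instance Definition _ := GRing.isMonoidMorphism.Build B A^c conv conv_monoid.

(* Naming the structure keeps unification from confusing A^c with A. *)
Definition opring : pzRingType := A^c.
Definition opcst : {rmorphism B -> opring} := conv.

End Converse.

Definition transp (n : nat) (T : Type) (f : 'I_n -> 'I_n -> T) i j := f j i.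

(* In the opposite ring the relations between the x's become those between
   the derivatives, with rhoR transposed. *)
Notation coord_rel c x :=
  (@dual_rel _ _ _ (transp rhoR) (opring _) (opcst c) x).

Section Relations.
Variables (K : fieldType) (n N N' : nat).
Local Notation B := (barU K n).
Variables (A : pzRingType) (c : {rmorphism B -> A}).

(** The defining relations speak only of constants and of the [h i]; the rule extends to all
    coefficients because it is stable under sums, products and inverses. *)
Lemma commute_sh (z : A) j :
  (forall a, c (constU a) * z = z * c (constU a)) ->
  (forall i, c (h i) * z = z * c (sh (dl j) (h i))) ->
  forall u, c u * z = z * c (sh (dl j) u).
Proof.
move=> zc zh; elim/barU_ind=> [a|i|u v IHu IHv|u v IHu IHv|u v uv IH].
- by rewrite sh_const zc.
- exact: zh.
- by rewrite !rmorphD mulrDl mulrDr IHu IHv.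
- by rewrite !rmorphM -mulrA IHv mulrA IHu mulrA.
- rewrite -[LHS]mulr1 -(rmorph1 c) -(rmorph1 (sh (dl j))) -uv !rmorphM.
  by rewrite !mulrA -(mulrA _ z) -IH mulrA -rmorphM (mulrC v) uv rmorph1 mul1r.
Qed.

Lemma sh_dl_h i j : sh (dl j) (h i) = h i - (i == j)%:R :> B.
Proof.
rewrite sh_h ffunE eq_sym.
by case: eqP => _; rewrite ?oppr0 ?subr0 ?addr0 ?mulrN1z.
Qed.

Variables (G : Type) (g : G -> A).

Lemma relVs_dual_rel (dt : 'I_n -> 'I_N -> term B G) :
  (forall s t, relVs dt s t -> eval c g s = eval c g t) <->
  dual_rel rhoR c (fun j b => eval c g (dt j b)).
Proof.
split=> [E|[E1 E2 E3] s t].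
  split=> [u j b|k a b|k l a b kl].
  - apply: commute_sh => [a|i]; first exact: (E _ _ (relVs_const dt a j b)).
    by rewrite sh_dl_h; exact: (E _ _ (relVs_h dt i j b)).
  - have := E _ _ (relVs_R dt k k a b); rewrite /= !eval_sum.
    under eq_bigr do rewrite eval_sum.
    by rewrite sum_R_lower eqxx.
  - have := E _ _ (relVs_R dt k l a b); rewrite /= !eval_sum.
    under eq_bigr do rewrite eval_sum.
    by rewrite sum_R_lower (negbTE kl).
case=> [a j b|i j b|k l a b] /=.
- by rewrite E1 sh_const.
- by rewrite E1 sh_dl_h.
- rewrite eval_sum; under eq_bigr do rewrite eval_sum.
  rewrite sum_R_lower; case: eqVneq => [->|kl]; [exact: E2 | exact: E3].
Qed.

End Relations.

Section ConverseRelations.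
Variables (K : fieldType) (n N' : nat).
Local Notation B := (barU K n).
Variables (A : pzRingType) (c : {rmorphism B -> A}) (G : Type) (g : G -> A).

(** Products are read in reverse, and the relation for [h i] is turned round into
    [x_j h_i = (h_i - delta_ij) x_j]. *)
Lemma relV_dual_rel (xt : 'I_n -> 'I_N' -> term B G) :
  (forall s t, relV xt s t -> eval c g s = eval c g t) <->
  coord_rel c (fun j b => eval c g (xt j b)).
Proof.
have nat_comm (z : A) (m : nat) : c m%:R * z = z * c m%:R.
  by rewrite rmorph_nat mulr_natl mulr_natr.
split=> [E|[E1 E2 E3] s t].
  split=> [u j b|k a b|k l a b kl].
  - apply: (@commute_sh K n (opring A) (opcst c)) => [a|i].
      exact/esym/(E _ _ (relV_const xt a j b)).
    have /= := E _ _ (relV_h xt i j b); rewrite rmorphD mulrDr => e.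
    rewrite sh_dl_h; change (eval c g (xt j b) * c (h i) =
      c (h i - (i == j)%:R) * eval c g (xt j b)).
    by rewrite rmorphB mulrBl e nat_comm addrK.
  - have := E _ _ (relV_R xt k k b a); rewrite /= !eval_sum.
    under eq_bigr do rewrite eval_sum.
    under eq_bigr do under eq_bigr do rewrite /= -mulrA.
    by rewrite sum_R_upper eqxx.
  - have := E _ _ (relV_R xt k l b a); rewrite /= !eval_sum.
    under eq_bigr do rewrite eval_sum.
    under eq_bigr do under eq_bigr do rewrite /= -mulrA.
    by rewrite sum_R_upper (negbTE kl).
case=> [a j b|i j b|k l a b] /=.
- by have := E1 (constU a) j b; rewrite sh_const => /esym.
- have := E1 (h i) j b; rewrite sh_dl_h.
  change (eval c g (xt j b) * c (h i) =
      c (h i - (i == j)%:R) * eval c g (xt j b) ->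
      c (h i) * eval c g (xt j b) = eval c g (xt j b) * c (h i + (i == j)%:R)).
  by rewrite rmorphB mulrBl rmorphD mulrDr nat_comm => ->; rewrite subrK.
- rewrite eval_sum; under eq_bigr do rewrite eval_sum.
  under eq_bigr do under eq_bigr do rewrite /= -mulrA.
  rewrite sum_R_upper; case: eqVneq => [->|kl]; [exact: E2 | exact: E3].
Qed.

End ConverseRelations.

Section Presentations.
Variables (K : fieldType) (n N N' : nat).
Local Notation B := (barU K n).

Lemma eval_gen (G : Type) (Rel : term B G -> term B G -> Prop) s :
  eval (cst Rel) (gen Rel) s = cls Rel s.
Proof.
elim: s => //= [s ->|s -> t ->|s -> t ->].
- by rewrite clsN.
- by rewrite clsD.
- by rewrite clsM.
Qed.

Lemma Rel_eval (G : Type) (Rel : term B G -> term B G -> Prop) s t :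
  Rel s t -> eval (cst Rel) (gen Rel) s = eval (cst Rel) (gen Rel) t.
Proof. by move=> st; rewrite !eval_gen; apply/clsP/CRel. Qed.

Definition dgen (j : 'I_n) (b : 'I_N) : Vs K n N := gen (relVs (@dVs K n N)) (j, b).
Definition xgen (j : 'I_n) (b : 'I_N') : V K n N' := gen (relV (@xV K n N')) (j, b).

Variable sigma : 'I_n -> 'I_N' -> 'I_N -> B.
Definition dLgen j b : L sigma := gen (relL sigma) (inr (j, b)).
Definition xLgen j b : L sigma := gen (relL sigma) (inl (j, b)).

Lemma Vs_rel : dual_rel rhoR (cst (relVs (@dVs K n N))) dgen.
Proof. exact: (relVs_dual_rel _ _ _).1 (@Rel_eval _ _). Qed.

Lemma V_rel : coord_rel (cst (relV (@xV K n N'))) xgen.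
Proof. exact: (relV_dual_rel _ _ _).1 (@Rel_eval _ _). Qed.

Lemma L_drel : dual_rel rhoR (cst (relL sigma)) dLgen.
Proof.
apply: (relVs_dual_rel (cst (relL sigma)) (gen (relL sigma))
  (@dL K n N N')).1 => s t st.
by apply/Rel_eval/Or32.
Qed.

Lemma L_xrel : coord_rel (cst (relL sigma)) xLgen.
Proof.
apply: (relV_dual_rel (cst (relL sigma)) (gen (relL sigma))
  (@xL K n N N')).1 => s t st.
by apply/Rel_eval/Or31.
Qed.

Lemma L_xd i a j b : xLgen i a * dLgen j b =
  \sum_r Phi rhoR (cst (relL sigma)) dLgen j b i r * xLgen r a -
  (if i == j then cst (relL sigma) (sigma i a b) else 0).
Proof.
have := Rel_eval (Or33 _ _
  (relVVs_R (@xL K n N N') (@dL K n N N') sigma i j a b) : relL sigma _ _).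
rewrite /= eval_sum => e; rewrite [LHS]e; congr (_ - _); last first.
  by case: eqP => _; rewrite ?mul1r // mul0r rmorph0.
rewrite -sum_R_Phi; apply: eq_bigr => k _; rewrite eval_sum.
by apply: eq_bigr.
Qed.

End Presentations.

(** * Ring morphisms out of the presented rings *)

Section Maps.
Variables (K : fieldType) (n N N' : nat).
Local Notation B := (barU K n).
Variables (A : pzRingType) (c : {rmorphism B -> A}).
Variables (d : 'I_n -> 'I_N -> A) (x : 'I_n -> 'I_N' -> A).

Section MapVs.
Hypothesis dP : dual_rel rhoR c d.

(** The proof of the relations is an argument, so that the morphism structure can be inferred from
    the map. *)
Definition Vs_map of dual_rel rhoR c d : Vs K n N -> A :=
  Defs.lift c (fun p => d p.1 p.2).

Fact Vs_map_rel s t : relVs (@dVs K n N) s t ->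
  eval c (fun p => d p.1 p.2) s = eval c (fun p => d p.1 p.2) t.
Proof. by move: s t; apply/relVs_dual_rel. Qed.

HB.instance Definition _ := GRing.isNmodMorphism.Build (Vs K n N) A (Vs_map dP)
  (lift_is_nmod_morphism Vs_map_rel).
HB.instance Definition _ := GRing.isMonoidMorphism.Build (Vs K n N) A (Vs_map dP)
  (lift_is_monoid_morphism Vs_map_rel).

Lemma Vs_map_gen j b : Vs_map dP (dgen K j b) = d j b.
Proof. exact: (Defs.lift_gen Vs_map_rel). Qed.

Lemma Vs_map_cst u : Vs_map dP (cst _ u) = c u.
Proof. exact: (Defs.lift_cst Vs_map_rel). Qed.
End MapVs.

Section MapV.
Hypothesis xP : coord_rel c x.

Definition V_map of coord_rel c x : V K n N' -> A :=
  Defs.lift c (fun p => x p.1 p.2).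

Fact V_map_rel s t : relV (@xV K n N') s t ->
  eval c (fun p => x p.1 p.2) s = eval c (fun p => x p.1 p.2) t.
Proof. by move: s t; apply/relV_dual_rel. Qed.

HB.instance Definition _ := GRing.isNmodMorphism.Build (V K n N') A (V_map xP)
  (lift_is_nmod_morphism V_map_rel).
HB.instance Definition _ := GRing.isMonoidMorphism.Build (V K n N') A (V_map xP)
  (lift_is_monoid_morphism V_map_rel).

Lemma V_map_gen j b : V_map xP (xgen K j b) = x j b.
Proof. exact: (Defs.lift_gen V_map_rel). Qed.

Lemma V_map_cst u : V_map xP (cst _ u) = c u.
Proof. exact: (Defs.lift_cst V_map_rel). Qed.
End MapV.

(** A pair of representations with common coefficients induces a balanced product, hence a map on
    the tensor product that can detect nonzero tensors. *)
Lemma pure_eq0 (dP : dual_rel rhoR c d)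
    (xP : coord_rel c x)
    (a : Vs K n N) (b : V K n N') :
  pure a b = 0 :> VsV K n N N' -> Vs_map dP a * V_map xP b = 0.
Proof.
pose H a b := Vs_map dP a * V_map xP b.
have HDl a1 a2 b' : H (a1 + a2) b' = H a1 b' + H a2 b'.
  by rewrite /H rmorphD mulrDl.
have HDr a' b1 b2 : H a' (b1 + b2) = H a' b1 + H a' b2.
  by rewrite /H rmorphD mulrDr.
have HB a' u b' : H (a' * cst _ u) b' = H a' (cst _ u * b').
  by rewrite /H !rmorphM /= Vs_map_cst V_map_cst mulrA.
move=> ab0; rewrite -[LHS]/(H a b) -(tlift_pure HDl HDr HB) ab0.
by rewrite -(pure0l _ _ 0) (tlift_pure HDl HDr HB) /H rmorph0 mul0r.
Qed.

End Maps.

(** * Necessity *)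

Section Coefficients.
Variables (K : fieldType) (n N : nat).
Local Notation B := (barU K n).
Variable w : {ffun 'I_n -> int}.

Definition corner_cst : {rmorphism B -> 'M[B]_2} :=
  shdiag idfun (fun i : 'I_2 => if i == ord0 then 0 else w).

(* Sends d_ka to an elementary matrix and the other generators to 0, thus reads
   off the coefficient of d_ka. *)
Definition corner (k : 'I_n) (a : 'I_N) j b : 'M[B]_2 :=
  if (j == k) && (b == a) then delta_mx ord0 ord_max else 0.

Lemma corner_mul k a j b j' b' : corner k a j b * corner k a j' b' = 0.
Proof.
rewrite /corner; case: ifP => _; last by rewrite mul0r.
by case: ifP => _; rewrite ?mulr0 // -[LHS]/(_ *m _) mul_delta_mx_0.
Qed.

(** Products of these matrices vanish, so the quadratic relations are trivial; the weight of the
    second index is chosen to absorb the shift by [dl k]. *)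
Lemma corner_dual_rel k a : w = - dl k -> dual_rel rhoR corner_cst (corner k a).
Proof.
move=> wE; split=> [u j b|k' a' b'|k' l a' b' kl]; last 2 first.
- by rewrite !corner_mul.
- by rewrite !corner_mul !mul0r addr0.
apply/matrixP => i1 i2; rewrite mul_mx_shdiag mul_shdiag_mx /corner.
case: andP => [[/eqP-> _]|_]; last by rewrite !mxE mulr0 mul0r.
rewrite !mxE; case: (i1 == ord0); last by rewrite mulr0 mul0r.
case: (eqVneq i2 ord_max) => [->|_] /=; last by rewrite mulr0 mul0r.
by rewrite sh0 wE shD addNr sh0 mulrC.
Qed.

Lemma corner_dual_rel_op k a : w = dl k ->
  coord_rel corner_cst (corner k a).
Proof.
have m0 j b j' b' :
    @GRing.mul (opring 'M[B]_2) (corner k a j b) (corner k a j' b') = 0.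
  exact: corner_mul.
move=> wE; split=> [u j b|k' a' b'|k' l a' b' kl]; last 2 first.
- by rewrite !m0.
- by rewrite !m0 !mul0r addr0.
apply/matrixP => i1 i2; rewrite -[LHS]/((corner k a j b * corner_cst u) i1 i2).
rewrite -[RHS]/((corner_cst (sh (dl j) u) * corner k a j b) i1 i2).
rewrite mul_mx_shdiag mul_shdiag_mx /corner.
case: andP => [[/eqP-> _]|_]; last by rewrite !mxE mulr0 mul0r.
rewrite !mxE; case: (i1 == ord0); last by rewrite mulr0 mul0r.
case: (eqVneq i2 ord_max) => [->|_] /=; last by rewrite mulr0 mul0r.
by rewrite sh0 wE mulrC.
Qed.

Lemma zero_dual_rel (rho : 'I_n -> 'I_n -> B) (A : pzRingType)
    (c : {rmorphism B -> A}) :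
  dual_rel rho c (fun (_ : 'I_n) (_ : 'I_N) => 0).
Proof. by split=> *; rewrite !(mul0r, mulr0, addr0). Qed.

End Coefficients.

(** The quadratic part of the mixed relation is the same seen from the x's or from the derivatives.
    The map [H] will be the product of the ring [L] or the formation of pure tensors. *)
Lemma sum_Phi_balanced (K : fieldType) (n N N' : nat)
    (rho : 'I_n -> 'I_n -> barU K n) (A1 A2 : pzRingType) (M : zmodType)
    (c1 : {rmorphism barU K n -> A1}) (c2 : {rmorphism barU K n -> A2})
    (H : A1 -> A2 -> M) (d : 'I_n -> 'I_N -> A1) (x : 'I_n -> 'I_N' -> A2) i j a b :
    (forall z, H 0 z = 0) -> (forall z, H z 0 = 0) ->
    (forall z u t, H (z * c1 u) t = H z (c2 u * t)) ->
  \sum_r H (Phi rho c1 d j b i r) (x r a) =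
  \sum_r H (d r b) (Phi (transp rho) (opcst c2) x i a j r).
Proof.
move=> H0l H0r HB; rewrite /Phi (eq_sym j); case: eqVneq => [->|ij].
  by apply: eq_bigr => r _; rewrite HB.
rewrite (bigD1 i) //= big1 => [|r ri]; last by rewrite (negbTE ri) H0l.
rewrite [RHS](bigD1 j) //= big1 => [|r rj]; last by rewrite (negbTE rj) H0r.
by rewrite !eqxx !addr0 HB.
Qed.

Section Necessity.
Variables (K : fieldType) (n N N' : nat).
Local Notation B := (barU K n).
Variable sigma : 'I_n -> 'I_N' -> 'I_N -> B.
Local Notation cL := (cst (relL sigma)).

Lemma VstoL_gen j b : VstoL sigma (dgen K j b) = dLgen sigma j b.
Proof. exact: (Defs.lift_gen (@VstoL_rel _ _ _ _ sigma)). Qed.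

Lemma VstoL_cst u : VstoL sigma (cst _ u) = cL u.
Proof. exact: (Defs.lift_cst (@VstoL_rel _ _ _ _ sigma)). Qed.

Lemma VtoL_gen j b : VtoL sigma (xgen K j b) = xLgen sigma j b.
Proof. exact: (Defs.lift_gen (@VtoL_rel _ _ _ _ sigma)). Qed.

Lemma VtoL_cst u : VtoL sigma (cst _ u) = cL u.
Proof. exact: (Defs.lift_cst (@VtoL_rel _ _ _ _ sigma)). Qed.

Hypothesis mul_inj : injective (mulVsV sigma).

Lemma pure_eq0_of_L (a : Vs K n N) (b : V K n N') :
  VstoL sigma a * VtoL sigma b = 0 -> pure a b = 0 :> VsV K n N N'.
Proof. by move=> ab0; apply: mul_inj; rewrite mulVsV_pure raddf0. Qed.

Lemma L_d_free k a b u v : a != b ->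
  dLgen sigma k a * cL u + dLgen sigma k b * cL v = 0 -> u = 0.
Proof.
move=> ab e; pose z := dgen K k a * cst _ u + dgen K k b * cst _ v.
have : pure z 1 = 0 :> VsV K n N N'.
  apply: pure_eq0_of_L; rewrite rmorph1 mulr1 rmorphD !rmorphM /=.
  by rewrite !VstoL_gen !VstoL_cst.
(* The x's are sent to 0, and of the derivatives only [d k a] survives. *)
move/(pure_eq0 (@corner_dual_rel K n N _ k a (erefl (- dl k)))
  (zero_dual_rel N' (transp rhoR) (opcst (corner_cst K (- dl k))))).
rewrite rmorph1 mulr1 rmorphD !rmorphM /= !Vs_map_gen !Vs_map_cst.
move/matrixP/(_ ord0 ord_max); rewrite mxE !mul_mx_shdiag /corner !eqxx.
rewrite (eq_sym b a) (negbTE ab) !mxE !eqxx mul1r mul0r addr0 /=.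
by move/(congr1 (sh (dl k))); rewrite shD subrr sh0 rmorph0.
Qed.

Lemma L_x_free k a b u v : a != b ->
  cL u * xLgen sigma k a + cL v * xLgen sigma k b = 0 -> u = 0.
Proof.
move=> ab e; pose z := cst _ u * xgen K k a + cst _ v * xgen K k b.
have : pure 1 z = 0 :> VsV K n N N'.
  apply: pure_eq0_of_L; rewrite rmorph1 mul1r rmorphD !rmorphM /=.
  by rewrite !VtoL_gen !VtoL_cst.
move/(pure_eq0 (zero_dual_rel N rhoR (corner_cst K (dl k)))
  (@corner_dual_rel_op K n N' _ k a (erefl (dl k)))).
rewrite rmorph1 mul1r rmorphD !rmorphM /= !V_map_gen !V_map_cst.
move/matrixP/(_ ord0 ord_max); rewrite mxE !mul_shdiag_mx /corner !eqxx.
rewrite (eq_sym b a) (negbTE ab) !mxE !eqxx mulr1 mulr0 addr0 /=.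
by rewrite sh0.
Qed.

Lemma const_of_inj :
    [pchar K] =i pred0 -> (0 < n)%N -> (1 < N)%N \/ (1 < N')%N ->
  exists s : 'I_N' -> 'I_N -> K, forall i a b, sigma i a b = constU (s a b).
Proof.
move=> charK0 n0 [N1|N1].
  suff /choice[s Hs] : forall a, exists s : 'I_N -> K,
      forall i b, sigma i a b = constU (s b).
    by exists s => i a b.
  move=> a; apply: (sigma_const (rhoR_ok K n) (L_drel sigma)
    (x := fun i => xLgen sigma i a) (sigma := fun i => sigma i a)) => //.
  - by move=> i u; have [+ _ _] := L_xrel sigma => /(_ u i a).
  - by move=> i j b; apply: L_xd.
  - exact: L_d_free.
suff /choice[s Hs] : forall b, exists s : 'I_N' -> K,
    forall i a, sigma i a b = constU (s a).
  by exists (fun a b => s b a) => i a b.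
(* With two x's available the argument is run in the opposite ring, where x's and derivatives change
   places. *)
move=> b; apply: (sigma_const (A := opring (L sigma))
  (rho_ok_tr (rhoR_ok K n)) (L_xrel sigma) (x := fun i => dLgen sigma i b)
  (sigma := fun i a => sigma i a b)) => //.
- by move=> i u; have [e _ _] := L_drel sigma; exact: (e u i b).
- move=> i j a; rewrite -[LHS]/(xLgen sigma j a * dLgen sigma i b) L_xd.
  rewrite (sum_Phi_balanced rhoR (c1 := cL) (c2 := cL) (H := *%R)).
  - by rewrite eq_sym; case: eqVneq => [->|].
  - exact: mul0r.
  - exact: mulr0.
  - by move=> *; rewrite mulrA.
- by move=> k a a' u v aa; apply: L_x_free.
Qed.

End Necessity.

(** * Sufficiency *)

Lemma presented_ind (B : pzRingType) (G : Type)
    (Rel : term B G -> term B G -> Prop) (P : presented Rel -> Prop) :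
    (forall u, P (cst Rel u)) -> (forall g, P (gen Rel g)) ->
    (forall x, P x -> P (- x)) -> (forall x y, P x -> P y -> P (x + y)) ->
    (forall x y, P x -> P y -> P (x * y)) ->
  forall x, P x.
Proof.
move=> Pc Pg PN PD PM x; rewrite -[x]repK; elim: (rep x) => //.
- by move=> s; rewrite clsN; apply: PN.
- by move=> s Ps t Pt; rewrite clsD; apply: PD.
- by move=> s Ps t Pt; rewrite clsM; apply: PM.
Qed.

(** * The ring of additive endomorphisms of a tensor product *)

Section TensorMaps.
Variables (B A1 A2 : pzRingType).
Variables (f1 : {rmorphism B -> A1}) (f2 : {rmorphism B -> A2}).
Local Notation W := (tensor f1 f2).

Lemma pure0r (a : A1) : pure a 0 = 0 :> W.
Proof. by apply: (addIr (pure a 0)); rewrite -pureDr !add0r. Qed.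

Lemma pureNl (a : A1) b : pure (- a) b = - pure a b :> W.
Proof. by apply: (addIr (pure a b)); rewrite -pureDl !addNr pure0l. Qed.

Lemma pureNr (a : A1) b : pure a (- b) = - pure a b :> W.
Proof. by apply: (addIr (pure a b)); rewrite -pureDr !addNr pure0r. Qed.

Lemma pure_suml (I : finType) (F : I -> A1) b :
  pure (\sum_i F i) b = \sum_i pure (F i) b :> W.
Proof.
exact: (big_morph (fun a => pure a b : W)
  (fun a a' => pureDl _ _ a a' b) (pure0l _ _ b)).
Qed.

Lemma pure_sumr (I : finType) a (F : I -> A2) :
  pure a (\sum_i F i) = \sum_i pure a (F i) :> W.
Proof.
exact: (big_morph (fun b => pure a b : W)
  (fun b b' => pureDr _ _ a b b') (pure0r a)).
Qed.

(** Only additivity is asked: the operators by which the x's will act shift the coefficients, so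
    they are not linear. *)
Record endo := Endo {
  endo_fun :> W -> W;
  endoD : {morph endo_fun : x y / x + y}
}.

Lemma endo0 (f : endo) : f 0 = 0.
Proof. by apply: (addIr (f 0)); rewrite -endoD !add0r. Qed.

Lemma endoN (f : endo) : {morph f : x / - x}.
Proof. by move=> x; apply: (addIr (f x)); rewrite -endoD !addNr endo0. Qed.

Lemma endo_sum (f : endo) (I : finType) (F : I -> W) :
  f (\sum_i F i) = \sum_i f (F i).
Proof. exact: (big_morph f (endoD f) (endo0 f)). Qed.

Lemma endo_eq (f g : endo) : f =1 g -> f = g.
Proof.
case: f g => f fD [g gD] /= /funext e; case: _ / e in gD *.
by congr Endo; apply: Prop_irrelevance.
Qed.

Lemma endo_ext (f g : endo) : (forall a b, f (pure a b) = g (pure a b)) -> f = g.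
Proof.
move=> fg; apply: endo_eq; elim/tensor_ind=> [|//|x IH|x y IHx IHy].
- by rewrite !endo0.
- by rewrite !endoN IH.
- by rewrite !endoD IHx IHy.
Qed.

HB.instance Definition _ := gen_eqMixin endo.
HB.instance Definition _ := gen_choiceMixin endo.

Fact endo_zero_morph : {morph (fun _ : W => 0 : W) : x y / x + y}.
Proof. by move=> *; rewrite addr0. Qed.
Fact endo_opp_morph (f : endo) : {morph (fun x => - f x) : x y / x + y}.
Proof. by move=> x y; rewrite endoD opprD. Qed.
Fact endo_add_morph (f g : endo) : {morph (fun x => f x + g x) : x y / x + y}.
Proof. by move=> x y; rewrite !endoD addrACA. Qed.
Fact endo_one_morph : {morph (@id W) : x y / x + y}.
Proof. by []. Qed.
Fact endo_mul_morph (f g : endo) : {morph f \o g : x y / x + y}.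
Proof. by move=> x y /=; rewrite !endoD. Qed.

Definition endo_add f g := Endo (endo_add_morph f g).
Definition endo_opp f := Endo (endo_opp_morph f).
Definition endo_mul f g := Endo (endo_mul_morph f g).

Fact endo_addA : associative endo_add.
Proof. by move=> f g k; apply: endo_eq => x /=; rewrite addrA. Qed.
Fact endo_addC : commutative endo_add.
Proof. by move=> f g; apply: endo_eq => x /=; rewrite addrC. Qed.
Fact endo_add0 : left_id (Endo endo_zero_morph) endo_add.
Proof. by move=> f; apply: endo_eq => x /=; rewrite add0r. Qed.
Fact endo_addN : left_inverse (Endo endo_zero_morph) endo_opp endo_add.
Proof. by move=> f; apply: endo_eq => x /=; rewrite addNr. Qed.
HB.instance Definition _ :=
  GRing.isZmodule.Build endo endo_addA endo_addC endo_add0 endo_addN.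

Fact endo_mulA : associative endo_mul.
Proof. by move=> f g k; apply: endo_eq. Qed.
Fact endo_mul1l : left_id (Endo endo_one_morph) endo_mul.
Proof. by move=> f; apply: endo_eq. Qed.
Fact endo_mul1r : right_id (Endo endo_one_morph) endo_mul.
Proof. by move=> f; apply: endo_eq. Qed.
Fact endo_mulDl : left_distributive endo_mul endo_add.
Proof. by move=> f g k; apply: endo_eq. Qed.
Fact endo_mulDr : right_distributive endo_mul endo_add.
Proof. by move=> f g k; apply: endo_eq => x /=; rewrite endoD. Qed.
HB.instance Definition _ := GRing.Zmodule_isPzRing.Build endo
  endo_mulA endo_mul1l endo_mul1r endo_mulDl endo_mulDr.

Lemma endoE_sum (I : finType) (F : I -> endo) w :
  (\sum_i F i) w = \sum_i F i w.
Proof.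
by apply: (big_morph (fun f : endo => f w)
  (id1 := 0) (op1 := +%R) (id2 := 0) (op2 := +%R)).
Qed.

Lemma endoM (f g : endo) w : (f * g) w = f (g w).
Proof. by []. Qed.

Lemma endoBE (f g : endo) w : (f - g) w = f w - g w.
Proof. by []. Qed.

Lemma endoDE (f g : endo) w : (f + g) w = f w + g w.
Proof. by []. Qed.

Section Tlift.
Variable H : A1 -> A2 -> W.
Hypotheses (HDl : forall a a' b, H (a + a') b = H a b + H a' b)
  (HDr : forall a b b', H a (b + b') = H a b + H a b')
  (HB : forall a u b, H (a * f1 u) b = H a (f2 u * b)).
Definition tlift_endo := Endo (tliftD HDl HDr HB).
Lemma tlift_endo_pure a b : tlift_endo (pure a b) = H a b.
Proof. exact: (tlift_pure HDl HDr HB). Qed.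
End Tlift.

Fact lmul_Dl a0 a a' b :
  pure (a0 * (a + a')) b =
  pure (a0 * a) b + pure (a0 * a') b :> W.
Proof. by rewrite mulrDr pureDl. Qed.
Fact lmul_Dr a0 a b b' :
  pure (a0 * a) (b + b') =
  pure (a0 * a) b + pure (a0 * a) b' :> W.
Proof. exact: pureDr. Qed.
Fact lmul_B a0 a u b :
  pure (a0 * (a * f1 u)) b = pure (a0 * a) (f2 u * b) :> W.
Proof. by rewrite mulrA pure_balanced. Qed.
Definition lmul a0 : endo := tlift_endo (lmul_Dl a0) (lmul_Dr a0) (lmul_B a0).
Lemma lmul_pure a0 a b : lmul a0 (pure a b) = pure (a0 * a) b.
Proof. exact: tlift_endo_pure. Qed.

Fact rmul_Dl b0 a a' b :
  pure (a + a') (b * b0) =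
  pure a (b * b0) + pure a' (b * b0) :> W.
Proof. exact: pureDl. Qed.
Fact rmul_Dr b0 a b b' :
  pure a ((b + b') * b0) =
  pure a (b * b0) + pure a (b' * b0) :> W.
Proof. by rewrite mulrDl pureDr. Qed.
Fact rmul_B b0 a u b :
  pure (a * f1 u) (b * b0) = pure a (f2 u * b * b0) :> W.
Proof. by rewrite pure_balanced mulrA. Qed.
Definition rmul b0 : endo := tlift_endo (rmul_Dl b0) (rmul_Dr b0) (rmul_B b0).
Lemma rmul_pure b0 a b : rmul b0 (pure a b) = pure a (b * b0).
Proof. exact: tlift_endo_pure. Qed.

Fact lmul_nmod : nmod_morphism lmul.
Proof.
split=> [|a a']; apply: endo_ext => a1 b; rewrite ?lmul_pure ?mul0r ?pure0l //.
by rewrite mulrDl pureDl -!lmul_pure.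
Qed.
Fact lmul_monoid : monoid_morphism lmul.
Proof.
split=> [|a a']; apply: endo_ext => a1 b; rewrite lmul_pure ?mul1r //.
by rewrite -mulrA -!lmul_pure.
Qed.
HB.instance Definition _ := GRing.isNmodMorphism.Build A1 endo lmul lmul_nmod.
HB.instance Definition _ := GRing.isMonoidMorphism.Build A1 endo lmul lmul_monoid.

Lemma lmul_rmul a b : lmul a * rmul b = rmul b * lmul a.
Proof.
apply: endo_ext => a1 b1.
by rewrite !endoM !(lmul_pure, rmul_pure).
Qed.

Lemma pure_lrmul a b : pure a b = lmul a (rmul b (pure 1 1)) :> W.
Proof. by rewrite rmul_pure lmul_pure mul1r mulr1. Qed.

End TensorMaps.

(** * The action on the tensor product for constant sigma *)

Section Sufficiency.
Variables (K : fieldType) (n N N' : nat).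
Local Notation B := (barU K n).
Local Notation cVs := (cst (relVs (@dVs K n N))).
Local Notation cV := (cst (relV (@xV K n N'))).
Local Notation W := (tensor cVs cV).
Variable s : 'I_N' -> 'I_N -> K.

Lemma left_mx_rel (a : 'I_N') :
  dual_rel rhoR (shdiag cVs (@bshift n))
    (bgen rhoR cVs (@dgen K n N) (fun _ b => constU (s a b))).
Proof.
apply: bgen_dual_rel => //; [exact: rhoR_ok | exact: Vs_rel |].
by move=> _ k b; apply: sh_const.
Qed.

(** Describes how the column of 1 and the x's passes an arbitrary element of V*; being a ring
    morphism, it is determined by the bordered matrices. *)
Definition left_mx a : Vs K n N -> 'M[Vs K n N]_n.+1 := Vs_map (left_mx_rel a).
HB.instance Definition _ a :=
  GRing.RMorphism.copy (left_mx a) (Vs_map (left_mx_rel a)).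

Lemma right_mx_rel (b : 'I_N) :
  @dual_rel K n N' (transp rhoR) 'M[opring (V K n N')]_n.+1
    (shdiag (opcst cV) (@bshift n))
    (bgen (transp rhoR) (opcst cV) (@xgen K n N') (fun _ a => constU (s a b))).
Proof.
apply: bgen_dual_rel => //; [exact/rho_ok_tr/rhoR_ok | exact: V_rel |].
by move=> _ k a; apply: sh_const.
Qed.

(** Entries and matrices are both taken in opposite rings: the x's then play the part of the
    derivatives. *)
Definition right_mx b : V K n N' -> opring 'M[opring (V K n N')]_n.+1 :=
  @V_map K n N' (opring 'M[opring (V K n N')]_n.+1)
    (opcst (shdiag (opcst cV) (@bshift n))) _ (right_mx_rel b).
HB.instance Definition _ b := GRing.RMorphism.copy (right_mx b)
  (@V_map K n N' (opring 'M[opring (V K n N')]_n.+1)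
    (opcst (shdiag (opcst cV) (@bshift n))) _ (right_mx_rel b)).

Lemma left_mxM a z z' I J :
  left_mx a (z * z') I J = \sum_Q left_mx a z I Q * left_mx a z' Q J.
Proof. by rewrite rmorphM mxE. Qed.

Lemma left_mx_cst a u I J :
  left_mx a (cVs u) I J = if I == J then cVs (sh (bshift I) u) else 0.
Proof. by rewrite /left_mx Vs_map_cst mxE. Qed.

Lemma left_mx_gen a j b I J : left_mx a (dgen K j b) I J =
  bgen rhoR cVs (@dgen K n N) (fun _ b => constU (s a b)) j b I J.
Proof. by rewrite /left_mx Vs_map_gen. Qed.

Lemma left_mx1 a I J : left_mx a 1 I J = (I == J)%:R.
Proof. by rewrite rmorph1 mxE. Qed.

Definition right_mxe b z (I J : 'I_n.+1) : V K n N' :=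
  (right_mx b z : 'M[opring (V K n N')]_n.+1) I J.

Lemma right_mxM b z z' I J : right_mxe b (z * z') I J =
  \sum_Q right_mxe b z Q J * right_mxe b z' I Q.
Proof. by rewrite /right_mxe rmorphM mxE. Qed.

Lemma right_mxD b z z' I J :
  right_mxe b (z + z') I J = right_mxe b z I J + right_mxe b z' I J.
Proof. by rewrite /right_mxe rmorphD mxE. Qed.

Lemma right_mx_cst b u I J :
  right_mxe b (cV u) I J = if I == J then cV (sh (bshift I) u) else 0.
Proof. by rewrite /right_mxe /right_mx V_map_cst mxE. Qed.

Lemma right_mx_gen b j a I J : right_mxe b (xgen K j a) I J =
  bgen (transp rhoR) (opcst cV) (@xgen K n N') (fun _ a => constU (s a b)) j a I J.
Proof. by rewrite /right_mxe /right_mx V_map_gen. Qed.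

Lemma right_mx1 b I J : right_mxe b 1 I J = (I == J)%:R.
Proof. by rewrite /right_mxe rmorph1 mxE. Qed.

Definition xcoef a (I : 'I_n.+1) : V K n N' :=
  if unlift ord0 I is Some i then xgen K i a else 1.
Definition dcoef b (I : 'I_n.+1) : Vs K n N :=
  if unlift ord0 I is Some i then dgen K i b else 1.

Lemma xcoef_cst a I u : xcoef a I * cV u = cV (sh (bshift I) u) * xcoef a I.
Proof.
elim/ord_lift_cases: I => [|i]; rewrite /xcoef /bshift ?unlift_none ?liftK.
  by rewrite sh0 mulr1 mul1r.
by have [e _ _] := @V_rel K n N'; have := e u i a => /esym.
Qed.

Lemma dcoef_cst b I u : cVs u * dcoef b I = dcoef b I * cVs (sh (bshift I) u).
Proof.
elim/ord_lift_cases: I => [|i]; rewrite /dcoef /bshift ?unlift_none ?liftK.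
  by rewrite sh0 mulr1 mul1r.
by have [e _ _] := @Vs_rel K n N; apply: e.
Qed.

(** Left multiplication by the entry [I] of the column: it passes [z] by [left_mx], and the
    resulting entries [J] join [t]. *)
Definition left_fun a I (z : Vs K n N) (t : V K n N') : W :=
  \sum_J pure (left_mx a z I J) (xcoef a J * t).
(** Right multiplication by 1 or a derivative, moved to the left through [t]. *)
Definition right_fun b I (z : Vs K n N) (t : V K n N') : W :=
  \sum_J pure (z * dcoef b J) (right_mxe b t I J).

Fact left_fun_Dl a I z z' t :
  left_fun a I (z + z') t = left_fun a I z t + left_fun a I z' t.
Proof.
by rewrite -big_split; apply: eq_bigr => J _ /=; rewrite rmorphD mxE pureDl.
Qed.
Fact left_fun_Dr a I z t t' :
  left_fun a I z (t + t') = left_fun a I z t + left_fun a I z t'.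
Proof.
by rewrite -big_split; apply: eq_bigr => J _ /=; rewrite mulrDr pureDr.
Qed.
Fact left_fun_B a I z u t :
  left_fun a I (z * cVs u) t = left_fun a I z (cV u * t).
Proof.
apply: eq_bigr => J _; rewrite left_mxM (bigD1 J) //= big1 => [|Q QJ].
  by rewrite addr0 left_mx_cst eqxx pure_balanced !mulrA xcoef_cst.
by rewrite left_mx_cst (negbTE QJ) mulr0.
Qed.
Definition left_op a I : endo cVs cV :=
  tlift_endo (left_fun_Dl a I) (left_fun_Dr a I) (left_fun_B a I).

Fact right_fun_Dl b I z z' t :
  right_fun b I (z + z') t = right_fun b I z t + right_fun b I z' t.
Proof.
by rewrite -big_split; apply: eq_bigr => J _ /=; rewrite mulrDl pureDl.
Qed.
Fact right_fun_Dr b I z t t' :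
  right_fun b I z (t + t') = right_fun b I z t + right_fun b I z t'.
Proof.
by rewrite -big_split; apply: eq_bigr => J _ /=; rewrite right_mxD pureDr.
Qed.
Fact right_fun_B b I z u t :
  right_fun b I (z * cVs u) t = right_fun b I z (cV u * t).
Proof.
apply: eq_bigr => J _; rewrite right_mxM (bigD1 J) //= big1 => [|Q QJ].
  by rewrite addr0 right_mx_cst eqxx -pure_balanced -!mulrA dcoef_cst.
by rewrite right_mx_cst (negbTE QJ) mul0r.
Qed.
Definition right_op b I : endo cVs cV :=
  tlift_endo (right_fun_Dl b I) (right_fun_Dr b I) (right_fun_B b I).

Lemma left_op_pure a I z t :
  left_op a I (pure z t) = \sum_J pure (left_mx a z I J) (xcoef a J * t).
Proof. exact: tlift_endo_pure. Qed.

Lemma right_op_pure b I z t :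
  right_op b I (pure z t) = \sum_J pure (z * dcoef b J) (right_mxe b t I J).
Proof. exact: tlift_endo_pure. Qed.

Local Notation lm := (lmul cVs cV).
Local Notation rm := (rmul cVs cV).
Local Notation e11 := (pure 1 1 : W).

Lemma left_op_lmul a I z :
  left_op a I * lm z = \sum_J lm (left_mx a z I J) * left_op a J.
Proof.
apply: endo_ext => z' t; rewrite endoM endoE_sum lmul_pure left_op_pure.
under [RHS]eq_bigr => Q do rewrite endoM left_op_pure endo_sum.
rewrite exchange_big; apply: eq_bigr => J _.
rewrite left_mxM pure_suml; apply: eq_bigr => Q _.
by rewrite lmul_pure.
Qed.

Lemma right_op_rmul b I t :
  right_op b I * rm t = \sum_J rm (right_mxe b t I J) * right_op b J.
Proof.
apply: endo_ext => z t'; rewrite endoM endoE_sum rmul_pure right_op_pure.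
under [RHS]eq_bigr => Q do rewrite endoM right_op_pure endo_sum.
rewrite exchange_big; apply: eq_bigr => J _.
rewrite right_mxM pure_sumr; apply: eq_bigr => Q _.
by rewrite rmul_pure.
Qed.

Lemma left_op_rmul a I t : left_op a I * rm t = rm t * left_op a I.
Proof.
apply: endo_ext => z t'; rewrite !endoM rmul_pure !left_op_pure endo_sum.
by apply: eq_bigr => J _; rewrite rmul_pure mulrA.
Qed.

Lemma right_op_lmul b I z : right_op b I * lm z = lm z * right_op b I.
Proof.
apply: endo_ext => z' t; rewrite !endoM lmul_pure !right_op_pure endo_sum.
by apply: eq_bigr => J _; rewrite lmul_pure mulrA.
Qed.

Lemma right_op_pure1 b I z : right_op b I (pure z 1) = pure (z * dcoef b I) 1.
Proof.
rewrite right_op_pure (bigD1 I) //= big1 => [|J JI].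
  by rewrite right_mx1 eqxx addr0.
by rewrite right_mx1 eq_sym (negbTE JI) pure0r.
Qed.

Lemma left_op_pure1 a I t : left_op a I (pure 1 t) = pure 1 (xcoef a I * t).
Proof.
rewrite left_op_pure (bigD1 I) //= big1 => [|J JI].
  by rewrite left_mx1 eqxx addr0.
by rewrite left_mx1 eq_sym (negbTE JI) pure0l.
Qed.

Lemma left_mx0 a z J : left_mx a z ord0 J = if J == ord0 then z else 0.
Proof.
elim/presented_ind: z J => [u|[j b]|z IH|z z' IH IH'|z z' IH IH'] J.
- by rewrite left_mx_cst eq_sym /bshift unlift_none sh0.
- rewrite left_mx_gen; elim/ord_lift_cases: J => [|q]; first by rewrite bgen00.
  by rewrite bgen0S.
- by rewrite rmorphN mxE IH; case: eqP; rewrite ?oppr0.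
- by rewrite rmorphD mxE IH IH'; case: eqP; rewrite ?addr0.
- rewrite left_mxM (bigD1 ord0) //= big1 => [|Q Q0]; last first.
    by rewrite IH (negbTE Q0) mul0r.
  by rewrite IH IH' eqxx addr0; case: eqP; rewrite ?mulr0.
Qed.

Lemma left_op0 a : left_op a ord0 = 1.
Proof.
apply: endo_ext => z t; rewrite left_op_pure (bigD1 ord0) //= big1 => [|Q Q0].
  by rewrite left_mx0 /xcoef unlift_none mul1r addr0.
by rewrite left_mx0 (negbTE Q0) pure0l.
Qed.

Lemma right_mx0 b t J : right_mxe b t ord0 J = if J == ord0 then t else 0.
Proof.
elim/presented_ind: t J => [u|[i a]|t IH|t t' IH IH'|t t' IH IH'] J.
- by rewrite right_mx_cst eq_sym /bshift unlift_none sh0.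
- rewrite right_mx_gen; elim/ord_lift_cases: J => [|q]; first by rewrite bgen00.
  by rewrite bgen0S.
- by rewrite /right_mxe rmorphN mxE [X in - X]IH; case: eqP; rewrite ?oppr0.
- by rewrite right_mxD IH IH'; case: eqP; rewrite ?addr0.
- rewrite right_mxM (bigD1 ord0) //= big1 => [|Q Q0]; last first.
    by rewrite IH' (negbTE Q0) mulr0.
  by rewrite IH IH' eqxx addr0; case: eqP; rewrite ?mul0r.
Qed.

(** For lifted indices both sides are the normal form of [x_i d_j], computed from the left and from
    the right. *)
Lemma left_right_op_e11 a I b J :
  left_op a I (right_op b J e11) = right_op b J (left_op a I e11).
Proof.
rewrite right_op_pure1 left_op_pure1 mul1r mulr1 left_op_pure right_op_pure.
under eq_bigr do rewrite mulr1; under [RHS]eq_bigr do rewrite mul1r.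
elim/ord_lift_cases: I => [|i].
  rewrite (bigD1 ord0) //= [RHS](bigD1 J) //= !big1 => [|Q QJ|Q Q0].
  - rewrite left_mx0 /xcoef unlift_none right_mx1 !eqxx !addr0 //.
  - by rewrite /xcoef unlift_none right_mx1 eq_sym (negbTE QJ) pure0r.
  - by rewrite left_mx0 (negbTE Q0) pure0l.
elim/ord_lift_cases: J => [|j].
  rewrite (bigD1 (lift ord0 i)) //= [RHS](bigD1 ord0) //= !big1 => [|Q Q0|Q Qi].
  - by rewrite right_mx0 /dcoef unlift_none left_mx1 !eqxx !addr0.
  - by rewrite right_mx0 (negbTE Q0) pure0r.
  - by rewrite /dcoef unlift_none left_mx1 eq_sym (negbTE Qi) pure0l.
(* The summand of index [ord0] carries the constant [s a b], which crosses the tensor sign; the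
   other summands agree by [sum_Phi_balanced]. *)
rewrite !big_ord_recl {1 2}/dcoef {1 3}/xcoef !unlift_none !liftK.
rewrite left_mx_gen right_mx_gen !bgenS0; congr (_ + _).
  rewrite eq_sym; case: eqP => _; last by rewrite pure0l pure0r.
  rewrite pureNl /dcoef unlift_none [RHS]pureNr; congr (- _).
  by have := pure_balanced cVs cV 1 (constU (s a b)) 1; rewrite mul1r mulr1.
under eq_bigr do rewrite left_mx_gen bgenSS {1}/xcoef liftK.
rewrite (sum_Phi_balanced rhoR (c1 := cVs) (c2 := cV)).
- apply: eq_bigr => r _.
  by rewrite /dcoef /xcoef !liftK right_mx_gen bgenSS.
- exact: pure0l.
- exact: pure0r.
- exact: pure_balanced.
Qed.

Lemma right_op_lmulE b I z w : right_op b I (lm z w) = lm z (right_op b I w).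
Proof. by rewrite -endoM right_op_lmul. Qed.

Lemma left_op_rmulE a I t w : left_op a I (rm t w) = rm t (left_op a I w).
Proof. by rewrite -endoM left_op_rmul. Qed.

Lemma left_op_lmulE a I z w :
  left_op a I (lm z w) = \sum_J lm (left_mx a z I J) (left_op a J w).
Proof. by rewrite -endoM left_op_lmul endoE_sum. Qed.

Lemma right_op_rmulE b I t w :
  right_op b I (rm t w) = \sum_J rm (right_mxe b t I J) (right_op b J w).
Proof. by rewrite -endoM right_op_rmul endoE_sum. Qed.

(* [left_op] passes [lmul] and [right_op] passes [rmul] up to a change of index,
   so everything is decided at 1 (x) 1. *)
Lemma left_right_op a I b J :
  left_op a I * right_op b J = right_op b J * left_op a I.
Proof.
apply: endo_ext => z t; rewrite !endoM pure_lrmul.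
rewrite right_op_lmulE !left_op_lmulE endo_sum; apply: eq_bigr => Q _.
rewrite right_op_lmulE left_op_rmulE; congr (endo_fun _ _).
rewrite !right_op_rmulE endo_sum; apply: eq_bigr => P _.
by rewrite left_op_rmulE left_right_op_e11.
Qed.

(* [right_op] and [rmul] generate W from 1 (x) 1. *)
Lemma endo_eq0 (f : endo cVs cV) :
    (forall t, GRing.comm (rm t) f) ->
    (forall b J, GRing.comm (right_op b J) f) ->
  f e11 = 0 -> f = 0.
Proof.
move=> fr fR f1; apply: endo_ext => z t.
have -> : pure z t = rm t (pure z 1) :> W by rewrite rmul_pure mul1r.
rewrite -endoM -fr endoM; suff -> : f (pure z 1) = 0 by rewrite endo0.
suff H y : f (pure y 1) = 0 -> f (pure (y * z) 1) = 0.
  by rewrite -[z]mul1r; apply: H.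
elim/presented_ind: z y => [u|[j b]|z IH|z z' IH IH'|z z' IH IH'] y fy.
- rewrite pure_balanced mulr1.
  have -> : pure y (cV u) = rm (cV u) (pure y 1) :> W by rewrite rmul_pure mul1r.
  by rewrite -endoM -fr endoM fy endo0.
- have <- : right_op b (lift ord0 j) (pure y 1) = pure (y * dgen K j b) 1.
    by rewrite right_op_pure1 /dcoef liftK.
  by rewrite -endoM -fR endoM fy endo0.
- by rewrite mulrN pureNl endoN IH ?oppr0.
- by rewrite mulrDr pureDl endoD IH ?IH' ?addr0.
- by rewrite mulrA; apply/IH'/IH.
Qed.

Definition endo_cst : {rmorphism B -> endo cVs cV} := lm \o cVs.

(** The defect of each quadratic relation commutes with all right operators and kills 1 (x) 1, where
    the relation becomes that of V; so [endo_eq0] applies. *)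
Lemma endo_x_rel :
  coord_rel endo_cst (fun i a => left_op a (lift ord0 i)).
Proof.
have opE (f g : endo cVs cV) : @GRing.mul (opring (endo cVs cV)) f g = g * f by [].
have [V1 V2 V3] := @V_rel K n N'.
have x1 i a t : left_op a (lift ord0 i) (pure 1 t) = pure 1 (xgen K i a * t).
  by rewrite left_op_pure1 /xcoef liftK.
split=> [u j a|k a b|k l a b kl].
- change (left_op a (lift ord0 j) * lm (cVs u) =
          lm (cVs (sh (dl j) u)) * left_op a (lift ord0 j)).
  rewrite left_op_lmul (bigD1 (lift ord0 j)) //= big1 => [|Q Qj].
    by rewrite left_mx_cst eqxx addr0 /bshift liftK.
  by rewrite left_mx_cst eq_sym (negbTE Qj) rmorph0 mul0r.
- apply/eqP; rewrite -subr_eq0 !opE; apply/eqP; apply: endo_eq0 => [t|c J|].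
  + by apply: commrB; apply: commrM; apply/commr_sym/left_op_rmul.
  + by apply: commrB; apply: commrM; apply/commr_sym/left_right_op.
  + by rewrite endoBE !endoM !x1 !mulr1 (V2 k a b : _ * _ = _ * _ :> V K n N') subrr.
- apply/eqP; rewrite -subr_eq0 !opE; apply/eqP; apply: endo_eq0 => [t|c J|].
  + apply: commrB; first by apply: commrM; apply/commr_sym/left_op_rmul.
    by apply: commrD; do 2?apply: commrM; apply/commr_sym;
      rewrite /GRing.comm ?left_op_rmul // lmul_rmul.
  + apply: commrB; first by apply: commrM; apply/commr_sym/left_right_op.
    by apply: commrD; do 2?apply: commrM; apply/commr_sym;
      rewrite /GRing.comm ?left_right_op // right_op_lmul.
  + have lm1 u t : lm (cVs u) (pure 1 t) = pure 1 (cV u * t).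
      by rewrite lmul_pure mulr1 -[in LHS](mul1r (cVs u)) pure_balanced.
    rewrite endoBE endoDE !endoM !x1 !mulr1 !lm1 -pureDr.
    have <- : xgen K k b * xgen K l a =
      cV (invh k l) * (xgen K k a * xgen K l b) +
      cV (transp rhoR l k) * (xgen K l a * xgen K k b) := V3 k l a b kl.
    exact: subrr.
Qed.

Lemma endo_cstE u : endo_cst u = lm (cVs u).
Proof. by []. Qed.

Lemma endo_d_rel : dual_rel rhoR endo_cst (fun j b => lm (dgen K j b)).
Proof.
have [V1 V2 V3] := @Vs_rel K n N; split=> [u j b|k a b|k l a b kl].
- by rewrite !endo_cstE -!rmorphM V1.
- by rewrite -!rmorphM V2.
- by rewrite !endo_cstE -!rmorphM -rmorphD V3.
Qed.

Lemma endo_xd i a j b : left_op a (lift ord0 i) * lm (dgen K j b) =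
  \sum_r Phi rhoR endo_cst (fun j b => lm (dgen K j b)) j b i r *
    left_op a (lift ord0 r) -
  (if i == j then endo_cst (constU (s a b)) else 0).
Proof.
rewrite left_op_lmul big_ord_recl left_op0 mulr1 addrC; congr (_ + _).
  apply: eq_bigr => r _; congr (_ * _); rewrite left_mx_gen bgenSS /Phi.
  by do 2?[case: eqP => _]; rewrite ?endo_cstE ?rmorphM ?rmorph0.
rewrite left_mx_gen bgenS0; case: eqP => _; first by rewrite rmorphN.
by rewrite rmorph0 oppr0.
Qed.

Let sigma (_ : 'I_n) a b : B := constU (s a b).

Lemma relL_eval (A : pzRingType) (c : {rmorphism B -> A})
    (d : 'I_n -> 'I_N -> A) (x : 'I_n -> 'I_N' -> A) :
    dual_rel rhoR c d -> coord_rel c x ->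
    (forall i a j b, x i a * d j b = \sum_r Phi rhoR c d j b i r * x r a -
                (if i == j then c (sigma i a b) else 0)) ->
  let g p := match p with inl p => x p.1 p.2 | inr p => d p.1 p.2 end in
  forall s t, relL sigma s t -> eval c g s = eval c g t.
Proof.
move=> dP xP xd g s1 t1 [st|st|st].
- by move: s1 t1 st; apply/relV_dual_rel.
- by move: s1 t1 st; apply/relVs_dual_rel.
case: st => i j a b /=; rewrite xd -sum_R_Phi eval_sum; congr (_ - _).
  by apply: eq_bigr => k _; rewrite eval_sum.
by case: eqP => _; rewrite ?mul1r // mul0r rmorph0.
Qed.

Definition act_gen (p : genL n N N') : endo cVs cV :=
  match p with
  | inl p => left_op p.2 (lift ord0 p.1)
  | inr p => lm (dgen K p.1 p.2)
  end.

Definition act : L sigma -> endo cVs cV := Defs.lift endo_cst act_gen.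

Let act_rel := relL_eval endo_d_rel endo_x_rel endo_xd.
HB.instance Definition _ := GRing.isNmodMorphism.Build (L sigma) (endo cVs cV)
  act (lift_is_nmod_morphism act_rel).
HB.instance Definition _ := GRing.isMonoidMorphism.Build (L sigma) (endo cVs cV)
  act (lift_is_monoid_morphism act_rel).

Lemma act_cst u : act (cst _ u) = lm (cVs u).
Proof. exact: (Defs.lift_cst act_rel). Qed.
Lemma act_d j b : act (dLgen sigma j b) = lm (dgen K j b).
Proof. exact: (Defs.lift_gen act_rel). Qed.
Lemma act_x i a : act (xLgen sigma i a) = left_op a (lift ord0 i).
Proof. exact: (Defs.lift_gen act_rel). Qed.

Lemma act_VstoL z : act (VstoL sigma z) = lm z.
Proof.
elim/presented_ind: z => [u|[j b]|z IH|z z' IH IH'|z z' IH IH'].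
- by rewrite VstoL_cst act_cst.
- by rewrite VstoL_gen act_d.
- by rewrite !rmorphN; congr (- _).
- by rewrite !rmorphD; congr (_ + _).
- by rewrite !rmorphM; congr (_ * _).
Qed.

Lemma act_VtoL t t' : act (VtoL sigma t) (pure 1 t') = pure 1 (t * t').
Proof.
elim/presented_ind: t t' => [u|[j b]|t IH|t t1 IH IH1|t t1 IH IH1] t'.
- rewrite VtoL_cst act_cst lmul_pure mulr1.
  by have := pure_balanced cVs cV 1 u t'; rewrite mul1r.
- by rewrite VtoL_gen act_x left_op_pure1 /xcoef liftK.
- by rewrite !rmorphN mulNr pureNr -IH.
- by rewrite !rmorphD mulrDl pureDr -IH -IH1.
- by rewrite !rmorphM endoM IH1 IH mulrA.
Qed.

Lemma act_mulVsV w : act (mulVsV sigma w) e11 = w.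
Proof.
elim/tensor_ind: w => [|z t|w IH|w w' IH IH'].
- by rewrite !raddf0.
- rewrite mulVsV_pure rmorphM -[LHS]/(act _ (act (VtoL sigma t) e11)) act_VtoL.
  by rewrite act_VstoL lmul_pure !mulr1.
- by rewrite !raddfN -[LHS]/(- act _ e11) IH.
- by rewrite !raddfD endoDE; congr (_ + _).
Qed.

Lemma mulVsV_lmul z w : mulVsV sigma (lm z w) = VstoL sigma z * mulVsV sigma w.
Proof.
elim/tensor_ind: w => [|z' t|w IH|w w' IH IH'].
- by rewrite endo0 !raddf0 mulr0.
- by rewrite lmul_pure !mulVsV_pure rmorphM mulrA.
- by rewrite endoN !raddfN mulrN; congr (- _).
- by rewrite endoD !raddfD mulrDr; congr (_ + _).
Qed.

(** In [L] itself the x's pass elements of V* by the rule encoded in [left_mx]. On generators this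
    is the mixed relation, and it is multiplicative in [z]. *)
Lemma left_mx_VstoL a I z :
  \sum_J VstoL sigma (left_mx a z I J) * VtoL sigma (xcoef a J) =
  VtoL sigma (xcoef a I) * VstoL sigma z.
Proof.
elim/presented_ind: z I => [u|[j b]|z IH|z z' IH IH'|z z' IH IH'] I.
- rewrite (bigD1 I) //= big1 => [|J JI].
    rewrite left_mx_cst eqxx addr0 !VstoL_cst -!(VtoL_cst sigma).
    rewrite -!(rmorphM (VtoL sigma)).
    by rewrite xcoef_cst.
  by rewrite left_mx_cst eq_sym (negbTE JI) rmorph0 mul0r.
- rewrite big_ord_recl left_mx_gen; elim/ord_lift_cases: I => [|i].
    rewrite big1 => [|r _]; last by rewrite left_mx_gen bgen0S rmorph0 mul0r.
    by rewrite bgen00 /xcoef unlift_none rmorph1 mulr1 mul1r addr0.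
  rewrite bgenS0 {1 3}/xcoef unlift_none liftK rmorph1 mulr1.
  rewrite VtoL_gen VstoL_gen L_xd addrC; congr (_ + _).
    apply: eq_bigr => r _; rewrite left_mx_gen bgenSS /xcoef liftK VtoL_gen.
    congr (_ * _); rewrite /Phi; do 2?[case: eqP => _];
    by rewrite ?rmorph0 // rmorphM /= VstoL_gen VstoL_cst.
  case: eqP => _; last by rewrite rmorph0 oppr0.
  by rewrite rmorphN /= VstoL_cst.
- rewrite (rmorphN (VstoL sigma)) mulrN -IH -sumrN; apply: eq_bigr => J _.
  by rewrite rmorphN mxE rmorphN mulNr.
- rewrite (rmorphD (VstoL sigma)) mulrDr -IH -IH' -big_split.
  apply: eq_bigr => J _ /=.
  by rewrite rmorphD mxE rmorphD mulrDl.
- rewrite (rmorphM (VstoL sigma)) mulrA -IH mulr_suml.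
  under [RHS]eq_bigr do rewrite -mulrA -IH' mulr_sumr.
  rewrite exchange_big; apply: eq_bigr => J _ /=.
  rewrite left_mxM rmorph_sum mulr_suml; apply: eq_bigr => Q _.
  by rewrite rmorphM mulrA.
Qed.

Lemma mulVsV_left_op a I w :
  mulVsV sigma (left_op a I w) = VtoL sigma (xcoef a I) * mulVsV sigma w.
Proof.
elim/tensor_ind: w => [|z t|w IH|w w' IH IH'].
- by rewrite endo0 !raddf0 mulr0.
- rewrite left_op_pure raddf_sum mulVsV_pure mulrA -left_mx_VstoL mulr_suml.
  by apply: eq_bigr => J _; rewrite /= mulVsV_pure rmorphM mulrA.
- by rewrite endoN !raddfN mulrN; congr (- _).
- by rewrite endoD !raddfD mulrDr; congr (_ + _).
Qed.

(** The multiplication map intertwines the action with left multiplication in [L], so its image is a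
    left ideal. *)
Lemma mulVsV_act y w : mulVsV sigma (act y w) = y * mulVsV sigma w.
Proof.
elim/presented_ind: y w => [u|[[i a]|[j b]]|y IH|y y' IH IH'|y y' IH IH'] w.
- by rewrite act_cst mulVsV_lmul VstoL_cst.
- rewrite -[gen _ _]/(xLgen sigma i a) act_x mulVsV_left_op.
  by rewrite /xcoef liftK VtoL_gen.
- rewrite -[gen _ _]/(dLgen sigma j b) act_d mulVsV_lmul.
  by rewrite VstoL_gen.
- rewrite rmorphN mulNr -IH -[X in mulVsV sigma X]/(- act y w).
  exact: raddfN.
- rewrite rmorphD mulrDl -IH -IH' endoDE; exact: raddfD.
- by rewrite rmorphM endoM IH IH' mulrA.
Qed.

Lemma PBW_const : PBW sigma.
Proof.
exists (fun y => act y e11) => [w|y]; first exact: act_mulVsV.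
(* The image of 1 (x) 1 is 1, so that of [act y e11] is [y]. *)
rewrite -[LHS]/(mulVsV sigma (act y e11)) mulVsV_act mulVsV_pure.
by rewrite !rmorph1 !mulr1.
Qed.

End Sufficiency.

Theorem lemma3p11 (K : fieldType) (charK0 : [pchar K] =i pred0)
    (n N N' : nat) (n_ge1 : (1 <= n)%N) (N_ge1 : (1 <= N)%N)
    (N'_ge1 : (1 <= N')%N) (NN'_gt1 : (1 < N)%N \/ (1 < N')%N)
    (sigma : 'I_n -> 'I_N' -> 'I_N -> barU K n) :
  PBW sigma <->
  exists sigma0 : 'I_N' -> 'I_N -> K,
    forall i alpha beta, sigma i alpha beta = constU (sigma0 alpha beta).
Proof.
split=> [/bij_inj mul_inj|[sigma0 sigmaE]]; first exact: const_of_inj.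
have -> : sigma = fun _ a b => constU (sigma0 a b).
  by do 3![apply/funext => ?]; apply: sigmaE.
exact: PBW_const.
Qed.
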